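(* Let $S$ be a bilateral weighted shift on a complex Hilbert space $\mathcal{H}$ with orthonormal basis $(e_n)_{n\in\mathbb{Z}}$ and bounded weight sequence $(\omega_n)_{n\in\mathbb{Z}}$ of positive real numbers, i.e. $Se_n=\omega_n e_{n+1}$ for all $n\in\mathbb{Z}$. Assume that $S$ satisfies Dunford's condition $(C)$. (a) If $S$ is not invertible, then $r_1(S)=r_2^-(S)=0\le r_3^+(S)=r(S)$. (b) If $S$ is invertible, then $r_1(S)=\frac{1}{r(S^{-1})}=r_2^-(S)\le r_3^+(S)=r(S)$.
   Context: For a bounded linear operator $T$ on $\mathcal{H}$: $r(T)$ is the spectral radius, $m(T)=\inf\{\|Tx\|:\|x\|=1\}$, and $r_1(T)=\sup_{n\ge1}[m(T^n)]^{1/n}=\lim_{n\to\infty}[m(T^n)]^{1/n}$. Put $\beta_n=\omega_0\cdots\omega_{n-1}$ for $n>0$, $\beta_0=1$, and $\beta_n=\frac{1}{\omega_n\cdots\omega_{-1}}$ for $n<0$. Define $r_2^-(S)=\liminf_{n\to+\infty}[1/\beta_{-n}]^{1/n}$ and $r_3^+(S)=\limsup_{n\to+\infty}\beta_n^{1/n}$. For $x\in\mathcal{H}$, the local resolvent set $\rho_T(x)$ is the union of all open $U\subset\mathbb{C}$ for which there is an analytic $f:U\to\mathcal{H}$ with $(T-\lambda)f(\lambda)=x$ for all $\lambda\in U$; the local spectrum is $\sigma_T(x)=\mathbb{C}\setminus\rho_T(x)$. $T$ satisfies Dunford's condition $(C)$ if for every closed $F\subset\mathbb{C}$ the linear subspace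 $\mathcal{H}_T(F)=\{x\in\mathcal{H}:\sigma_T(x)\subset F\}$ is closed. *)

(* Defs.v *)
From HB Require Import structures.
From mathcomp Require Import all_boot all_order all_algebra.
From mathcomp Require Import all_classical all_reals all_analysis.
From mathcomp Require Import complex.

Set Implicit Arguments.
Unset Strict Implicit.
Unset Printing Implicit Defensive.

Import Order.TTheory GRing.Theory Num.Theory.
Import numFieldNormedType.Exports.

Local Open Scope classical_set_scope.
Local Open Scope ring_scope.
Local Open Scope complex_scope.

(* The norm of a normed space over R[i] takes its values in R[i] (in the
   nonnegative reals); [rnorm] is the same number in R. *)
Definition rnorm (R : realType) (V : normedZmodType R[i]) (x : V) : R :=
  complex.Re `|x|.

Section HilbertSpace.
Variables (R : realType) (H : completeNormedModType R[i]).

(* Together with completeness of H, this makes (H, dot) a Hilbert space. *)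
Definition hilbert_norm (dot : {dot H for Num.conj}) : Prop :=
  forall x : H, `|x| ^+ 2 = dot x x.

Definition orthonormal_basis (dot : {dot H for Num.conj}) (e : int -> H) : Prop :=
  (forall i j : int, dot (e i) (e j) = (i == j)%:R) /\
  dense [set x : H | exists (s : seq int) (c : int -> R[i]),
                       x = \sum_(i <- s) c i *: e i].

End HilbertSpace.

Section Operators.
Variables (R : realType) (H : completeNormedModType R[i]).

(* R[i] only carries its canonical topology through the alias (R[i])^o. *)
Local Notation C := (R[i])^o.

Definition bounded_operator (T : H -> H) : Prop :=
  exists M : R, forall x : H, rnorm (T x) <= M * rnorm x.

Definition inverse_operator (T : H -> H) (T' : {linear H -> H}) : Prop :=
  [/\ bounded_operator T', cancel T T' & cancel T' T].

Definition invertible (T : H -> H) : Prop :=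
  exists T' : {linear H -> H}, inverse_operator T T'.

Definition spectrum (T : H -> H) : set C :=
  [set l | ~ invertible (fun x => T x - l *: x)].

Definition spectral_radius (T : H -> H) : R :=
  sup [set rnorm l | l in spectrum T].

Definition min_modulus (T : H -> H) : R :=
  inf [set rnorm (T x) | x in [set x : H | rnorm x = 1]].

Definition r1 (T : H -> H) : R :=
  sup [set min_modulus (iter n T) `^ (n%:R^-1) | n in [set n : nat | (0 < n)%N]].

(* [derivable f l 1] is differentiability of f in the complex variable at l. *)
Definition analytic_on (U : set C) (f : C -> H) : Prop :=
  forall l : C, U l -> derivable f l 1.

Definition local_resolvent_set (T : H -> H) (x : H) : set C :=
  \bigcup_(U in [set U : set C | open U /\
     exists2 f : C -> H, analytic_on U f &
       forall l : C, U l -> T (f l) - l *: f l = x]) U.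

Definition local_spectrum (T : H -> H) (x : H) : set C :=
  ~` local_resolvent_set T x.

Definition local_spectral_subspace (T : H -> H) (F : set C) : set H :=
  [set x | local_spectrum T x `<=` F].

Definition dunford_condition_C (T : H -> H) : Prop :=
  forall F : set C, closed F -> closed (local_spectral_subspace T F).

End Operators.

Section WeightedShift.
Variables (R : realType).

Definition bilateral_weighted_shift (H : completeNormedModType R[i])
    (e : int -> H) (w : int -> R) (S : H -> H) : Prop :=
  forall n : int, S (e n) = (w n)%:C *: e (n + 1).

(* [Negz k] is the integer -(k+1), so the second branch is
   1 / (w_(-1) * ... * w_(-(k+1))). *)
Definition beta (w : int -> R) (n : int) : R :=
  match n with
  | Posz k => \prod_(i < k) w (Posz i)
  | Negz k => (\prod_(i < k.+1) w (Negz i))^-1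
  end.

Definition r2_minus (w : int -> R) : R :=
  limn_inf (fun n : nat => (beta w (- n%:Z))^-1 `^ (n%:R^-1)).

Definition r3_plus (w : int -> R) : R :=
  limn_sup (fun n : nat => beta w n%:Z `^ (n%:R^-1)).

End WeightedShift.

(* Main.v *)
Require Import Defs.
From HB Require Import structures.
From mathcomp Require Import all_boot all_order all_algebra.
From mathcomp Require Import all_classical all_reals all_analysis.
From mathcomp Require Import complex.
From mathcomp Require Import ring lra.
Set Implicit Arguments.
Unset Strict Implicit.
Unset Printing Implicit Defensive.
Import Order.TTheory GRing.Theory Num.Theory.
Import numFieldNormedType.Exports.
Local Open Scope classical_set_scope.
Local Open Scope ring_scope.
Local Open Scope complex_scope.

(** Write [r3] for the limit superior of the roots of the forward weight
    products, [r2] for the limit inferior of the roots of the backward ones, and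
    [e n] for the basis. The vector [e k] is divisible by [S - l] in two ways: by
    the forward Neumann series [- sum l^(-n-1) S^n (e k)], which converges for
    [|l| > r3], and by a backward series along [e (k - 1), e (k - 2), ...], which
    converges for [|l| < r2]. Conversely [S f - l f = e k] is a two-term
    recurrence for the coordinates of [f]: a nonzero coordinate at [k - 1] forces
    [|l| <= r2], a nonzero coordinate at [k] forces [r3 <= |l|]
    ([resolvent_backward], [resolvent_forward]), and an eigenvalue satisfies
    [r3 <= |l| <= r2] ([eigenvalue_radius]).

    By the two series, finite combinations of basis vectors have their local
    spectrum in the disc [|l| <= r3] and in the complement of the disc
    [|l| < r2]. Condition (C) makes the corresponding local spectral subspaces
    closed, hence equal to the whole space, so that [S - l] is onto for
    [|l| > r3] and for [|l| < r2] ([surjective_outer], [surjective_inner]).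

    If [r3 < r2], all [S - l] would be onto; with the open mapping theorem this
    contradicts the eigenvectors present just below [r2] and absent just above
    it. So [r2 <= r3] ([r2_le_r3]), there is no eigenvalue in the two regions,
    and [S - l] is invertible there. This gives [r(S) <= r3], [r(S^-1) <= 1 / r2]
    when [S] is invertible, and [r2 = 0] when it is not.

    For the reverse inequalities, suppose that [S - r] is invertible with [r] a
    positive number. If [r2 < r < r3], the recurrence has no solution. If
    [r = r2 = r3], the forward solutions above [r] and the backward solutions
    below [r] would have the same limit, but their coordinates at [-1] stay apart
    ([common_radius_in_spectrum]). Hence [r(S) >= r3]. If [r < r3], the solution
    for every [e k] is the backward one, and the norm of the inverse of [S - r]
    bounds all products of [n] consecutive weights from below by a multiple of
    [r^n]; the Pythagorean theorem turns this into [r <= r1] ([r1_ge]). Together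
    with [r1 <= r2], obtained by cutting the negative axis into blocks, this
    closes the chain [1 / r(S^-1) <= r1 <= r2 <= 1 / r(S^-1)]. *)

(** * Real-valued norms and sums of geometric speed *)

Section RealNorm.
Variable R : realType.

Section Zmod.
Variable V : normedZmodType R[i].
Implicit Types x y z : V.

Lemma rnormE x : `|x| = (rnorm x)%:C.
Proof. by rewrite /rnorm RRe_real// ger0_real. Qed.

Lemma rnorm_ge0 x : 0 <= rnorm x.
Proof. by rewrite -ler0c -rnormE. Qed.

Lemma rnormD x y : rnorm (x + y) <= rnorm x + rnorm y.
Proof. by rewrite -lecR rmorphD/= -!rnormE ler_normD. Qed.

Lemma rnormN x : rnorm (- x) = rnorm x.
Proof. by rewrite /rnorm normrN. Qed.

Lemma rnormBC x y : rnorm (x - y) = rnorm (y - x).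
Proof. by rewrite /rnorm distrC. Qed.

Lemma rnormB x y : rnorm (x - y) <= rnorm x + rnorm y.
Proof. by rewrite -(rnormN y) rnormD. Qed.

Lemma rnorm0 : rnorm (0 : V) = 0.
Proof. by rewrite /rnorm normr0. Qed.

Lemma rnorm_eq0 x : (rnorm x == 0) = (x == 0).
Proof. by rewrite -[RHS]normr_eq0 rnormE (inj_eq (@complexI R)). Qed.

Lemma rnorm_gt0 x : (0 < rnorm x) = (x != 0).
Proof. by rewrite lt_def rnorm_eq0 rnorm_ge0 andbT. Qed.

Lemma rnorm_le0 x : rnorm x <= 0 -> x = 0.
Proof.
by move=> h; apply/eqP; rewrite -rnorm_eq0 eq_le h rnorm_ge0.
Qed.

Lemma rnorm_dist x y z : rnorm (x - z) <= rnorm (x - y) + rnorm (y - z).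
Proof. by rewrite (le_trans _ (rnormD _ _))// addrA subrK. Qed.

Lemma rnorm_sum (I : Type) (r : seq I) (P : pred I) (F : I -> V) :
  rnorm (\sum_(i <- r | P i) F i) <= \sum_(i <- r | P i) rnorm (F i).
Proof.
elim/big_ind2 : _ => [|x1 x2 y1 y2 h1 h2|//]; first by rewrite rnorm0.
exact: le_trans (rnormD _ _) (lerD h1 h2).
Qed.

End Zmod.

Lemma rnormM (a b : R[i]) : rnorm (a * b) = rnorm a * rnorm b.
Proof. by apply: complexI; rewrite rmorphM/= -!rnormE normrM. Qed.

Lemma rnorm1 : rnorm (1 : R[i]) = 1.
Proof. by apply: complexI; rewrite -rnormE normr1. Qed.

Lemma rnormX (a : R[i]) n : rnorm (a ^+ n) = rnorm a ^+ n.
Proof.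
by elim: n => [|n ih]; rewrite ?expr0 ?rnorm1// !exprS rnormM ih.
Qed.

Lemma rnormV (a : R[i]) : rnorm a^-1 = (rnorm a)^-1.
Proof. by apply: complexI; rewrite fmorphV/= -!rnormE normfV. Qed.

Lemma rnorm_real (r : R) : rnorm r%:C = `|r|.
Proof.
by apply: complexI; rewrite -rnormE normc_def/= expr0n addr0 sqrtr_sqr.
Qed.

Lemma rnorm_pos (r : R) : 0 <= r -> rnorm r%:C = r.
Proof. by move=> r0; rewrite rnorm_real ger0_norm. Qed.

Lemma rnormZ (V : normedModType R[i]) (a : R[i]) (x : V) :
  rnorm (a *: x) = rnorm a * rnorm x.
Proof. by apply: complexI; rewrite rmorphM/= -!rnormE normrZ. Qed.

End RealNorm.

Section Metric.
Variables (R : realType) (V : normedModType R[i]).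

Lemma nbhs_rnormP (x : V) (A : set V) :
  nbhs x A <-> exists2 d : R, 0 < d & forall y, rnorm (x - y) < d -> A y.
Proof.
split => [/nbhs_ballP[d /= d0 dA]|[d d0 dA]].
  have dr : d \is Num.real by rewrite gtr0_real.
  exists (complex.Re d) => [|y xy].
    by rewrite -ltcR RRe_real.
  apply: dA; rewrite -ball_normE/= rnormE -(RRe_real dr).
  by rewrite ltcR.
apply/nbhs_ballP; exists d%:C => /=; first by rewrite ltcR.
by move=> y; rewrite -ball_normE/= rnormE ltcR => /dA.
Qed.

Lemma open_rnormP (A : set V) : open A <->
  forall x, A x -> exists2 d : R, 0 < d & forall y, rnorm (x - y) < d -> A y.
Proof.
rewrite openE; split => [oA x /oA/nbhs_rnormP//|h x /h Ax].
exact/nbhs_rnormP.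
Qed.

Lemma closed_rnorm (A : set V) (x : V) : closed A ->
  (forall d : R, 0 < d -> exists2 y, A y & rnorm (x - y) < d) -> A x.
Proof.
move=> cA h; apply: cA => B /nbhs_rnormP[d d0 dB].
by have [y Ay xy] := h _ d0; exists y; split => //; apply: dB.
Qed.

Lemma dense_rnorm (A : set V) (x : V) (d : R) : dense A -> 0 < d ->
  exists2 y, A y & rnorm (x - y) < d.
Proof.
move=> dA d0; have [||y [/= xy Ay]] := dA [set y | rnorm (x - y) < d].
- by exists x; rewrite /= subrr rnorm0.
- apply/open_rnormP => y /= xy; exists (d - rnorm (x - y)).
    by rewrite subr_gt0.
  move=> z yz; rewrite (le_lt_trans (rnorm_dist _ y _))//.
  by rewrite -ltrBrDl.
- by exists y.
Qed.

Lemma open_rnorm_lt (c : V) (r : R) : open [set x | rnorm (x - c) < r].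
Proof.
apply/open_rnormP => y /= xy; exists (r - rnorm (y - c)).
  by rewrite subr_gt0.
move=> z yz; rewrite (le_lt_trans (rnorm_dist _ y _))//.
by rewrite -ltrBrDr rnormBC.
Qed.

Lemma closed_rnorm_le (r : R) : closed [set x : V | rnorm x <= r].
Proof.
rewrite -openC; apply/open_rnormP => x /= /negP; rewrite -ltNge => rx.
exists (rnorm x - r); first by rewrite subr_gt0.
move=> y xy; apply/negP; rewrite -ltNge.
have := rnorm_dist x y 0; rewrite !subr0 => h.
by rewrite -(ltrD2l (rnorm (x - y))); apply: lt_le_trans h; rewrite -ltrBrDr.
Qed.

Lemma closed_rnorm_ge (r : R) : closed [set x : V | r <= rnorm x].
Proof.
rewrite -openC [X in open X](_ : _ = [set x | rnorm (x - 0) < r]).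
  exact: open_rnorm_lt.
by apply/seteqP; split => x /=; rewrite subr0 ltNge => /negP.
Qed.

End Metric.

(** A quadratic remainder is what two successive factorisations of the increment
    of a power series provide. *)
Lemma derivable_quadratic (R : realType) (V : normedModType R[i])
  (f : (R[i])^o -> V) (l : (R[i])^o) (d : V) (K r : R) : 0 < r ->
  (forall h : (R[i])^o, rnorm h < r ->
     rnorm (f (h + l) - f l - h *: d) <= K * rnorm h ^+ 2) ->
  derivable f l 1.
Proof.
move=> r0 hK; apply/cvg_ex; exists d.
move=> A /nbhs_rnormP[e e0 eA].
have K0 : 0 < 1 + `|K| by rewrite ltr_pwDl.
apply/nbhs_rnormP; exists (Num.min r (e / (1 + `|K|))).
  by rewrite lt_min r0 divr_gt0.
move=> h; rewrite sub0r rnormN lt_min => /andP[hr he] h0.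
apply: eA; rewrite rnormBC.
have nh0 : 0 < rnorm h by rewrite rnorm_gt0.
have -> : h^-1 *: (f (h *: (1:(R[i])^o) + l) - f l) - d =
          h^-1 *: (f (h + l) - f l - h *: d).
  by rewrite [RHS]scalerBr scalerA mulVf// scale1r /GRing.scale/= mulr1.
rewrite rnormZ rnormV -ltr_pdivlMl ?invr_gt0// invrK.
rewrite (le_lt_trans (hK _ hr))// expr2 mulrCA ltr_pM2l//.
rewrite ltr_pdivlMr// in he.
rewrite (le_lt_trans _ he)// mulrC ler_wpM2l ?rnorm_ge0//.
by rewrite (le_trans (ler_norm _))// lerDr.
Qed.

Section GeometricSums.
Variables (R : realType) (H : completeNormedModType R[i]).
Implicit Types (u v : nat -> H) (s t : H).

(** The rate is part of the notion: it makes sums unique and stable under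
    bounded operators by plain estimates, and every series that occurs has it. *)
Definition geom_sum u s := exists K q : R,
  [/\ 0 <= q, q < 1 & forall N, rnorm (s - \sum_(n < N) u n) <= K * q ^+ N].

Lemma geom_small (K q d : R) : 0 <= q -> q < 1 -> 0 < d ->
  exists N, forall n, (N <= n)%N -> K * q ^+ n < d.
Proof.
move=> q0 q1 d0.
have : ((fun n => `|K| * q ^+ n) @ \oo --> (0:R)).
  by apply: cvg_geometric; rewrite ger0_norm.
move=> /cvgrPdist_lt/(_ _ d0)[N _ NP]; exists N => n Nn.
have := NP n Nn; rewrite sub0r normrN; apply: le_lt_trans.
by rewrite ger0_norm ?mulr_ge0 ?exprn_ge0// ler_wpM2r ?exprn_ge0// ler_norm.
Qed.

Lemma geom_sum_uniq u s t : geom_sum u s -> geom_sum u t -> s = t.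
Proof.
move=> [K [q [q0 q1 h]]] [K' [q' [q'0 q'1 h']]].
apply/eqP; rewrite -subr_eq0; apply/eqP/rnorm_le0/ler_addgt0Pr => e e0.
rewrite add0r.
have e20 : 0 < e / 2 by rewrite divr_gt0.
have [N hN] := geom_small K q0 q1 e20.
have [N' hN'] := geom_small K' q'0 q'1 e20.
have := rnorm_dist s (\sum_(n < N + N') u n) t.
move=> /le_trans; apply; rewrite [e]splitr lerD//.
  by apply: le_trans (h _) (ltW (hN _ (leq_addr _ _))).
rewrite rnormBC.
by apply: le_trans (h' _) (ltW (hN' _ (leq_addl _ _))).
Qed.

(** The only use of the completeness of [H]. *)
Lemma geom_sum_exists u (K q : R) : 0 <= q -> q < 1 ->
  (forall n, rnorm (u n) <= K * q ^+ n) ->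
  exists2 s, geom_sum u s & rnorm s <= K / (1 - q).
Proof.
move=> q0 q1 uK.
have q1' : 0 < 1 - q by rewrite subr_gt0.
have K0 : 0 <= K by apply: le_trans (rnorm_ge0 (u 0)) _; rewrite (le_trans (uK 0))// expr0 mulr1.
pose p N := \sum_(n < N) u n.
have pd N k : rnorm (p (N + k)%N - p N) <= K / (1 - q) * q ^+ N * (1 - q ^+ k).
  elim: k => [|k ih]; first by rewrite addn0 subrr rnorm0 expr0 subrr mulr0.
  rewrite addnS /p big_ord_recr/= -/(p _) addrAC.
  apply: le_trans (rnormD _ _) _; apply: le_trans (lerD ih (uK _)) _.
  rewrite exprD exprS le_eqVlt; apply/orP; left; apply/eqP.
  by field; rewrite gt_eqF.
have pd' N k : rnorm (p (N + k)%N - p N) <= K / (1 - q) * q ^+ N.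
  apply: le_trans (pd _ _) _.
  by rewrite ler_piMr ?mulr_ge0 ?exprn_ge0 ?invr_ge0 ?(ltW q1')// gerBl exprn_ge0.
have cp : cvgn p.
  apply: cauchy_cvg; apply: cauchy_exP => e e0.
  have er : e \is Num.real by rewrite gtr0_real.
  have e0' : 0 < complex.Re e by rewrite -ltcR RRe_real.
  have [N hN] := geom_small (K / (1 - q)) q0 q1 e0'.
  exists (p N); exists N => // n /= Nn.
  rewrite -ball_normE/= rnormE -(RRe_real er) ltcR rnormBC -(subnKC Nn).
  exact: le_lt_trans (pd' _ _) (hN _ _).
have [s ps] : exists s, p @ \oo --> s by apply/cvg_ex.
have ub N : rnorm (s - p N) <= K / (1 - q) * q ^+ N.
  apply/ler_addgt0Pr => e e0.
  have /ps[N' _ hN'] : nbhs s [set y | rnorm (s - y) < e].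
    by apply/nbhs_rnormP; exists e.
  apply: le_trans (rnorm_dist _ (p (N + N')%N) _) _; rewrite addrC lerD//.
  by apply: ltW; apply: hN'; rewrite /= leq_addl.
exists s; first by exists (K / (1 - q)), q; split.
by have := ub 0%N; rewrite /p big_ord0 subr0 expr0 mulr1.
Qed.

Lemma geom_sum_linear (T : {linear H -> H}) u s : bounded_operator T ->
  geom_sum u s -> geom_sum (T \o u) (T s).
Proof.
move=> [M TM] [K [q [q0 q1 h]]]; exists (`|M| * K), q; split => // N.
rewrite /= -linear_sum -linearB (le_trans (TM _))// -mulrA.
rewrite (le_trans (ler_wpM2r (rnorm_ge0 _) (ler_norm M)))//.
by apply: ler_wpM2l (h N); exact: normr_ge0.
Qed.

Lemma geom_sum_scale (a : R[i]) u s :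
  geom_sum u s -> geom_sum (fun n => a *: u n) (a *: s).
Proof.
move=> [K [q [q0 q1 h]]]; exists (rnorm a * K), q; split => // N.
by rewrite -scaler_sumr -scalerBr rnormZ -mulrA ler_wpM2l ?rnorm_ge0.
Qed.

Lemma geom_sumB u v s t :
  geom_sum u s -> geom_sum v t -> geom_sum (fun n => u n - v n) (s - t).
Proof.
move=> [K [q [q0 q1 h]]] [K' [q' [q'0 q'1 h']]].
exists (`|K| + `|K'|), (Num.max q q'); split.
- by rewrite le_max q0.
- by rewrite gt_max q1.
move=> N; rewrite sumrB.
rewrite (_ : _ - _ = s - \sum_(i < N) u i - (t - \sum_(i < N) v i)); last first.
  by rewrite opprB [- (t - _)]opprB [in LHS](addrC (\sum_(i < N) v i)) addrACA (addrC (- t)).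
rewrite (le_trans (rnormB _ _))// mulrDl lerD//.
- apply: le_trans (h _) _; apply: le_trans (ler_wpM2r _ (ler_norm _)) _.
    by rewrite exprn_ge0.
  by rewrite ler_wpM2l// lerXn2r ?nnegrE ?le_max ?q0 ?lexx.
- apply: le_trans (h' _) _; apply: le_trans (ler_wpM2r _ (ler_norm _)) _.
    by rewrite exprn_ge0.
  by rewrite ler_wpM2l// lerXn2r ?nnegrE ?le_max ?q0 ?lexx ?orbT.
Qed.

Lemma geom_sum_shift u s :
  geom_sum u s -> geom_sum (fun n => u n.+1) (s - u 0%N).
Proof.
move=> [K [q [q0 q1 h]]]; exists (K * q), q; split => // N.
by have := h N.+1; rewrite big_ord_recl/= opprD addrA exprS mulrA.
Qed.

Lemma eq_geom_sum u v s : u =1 v -> geom_sum u s -> geom_sum v s.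
Proof. by move=> /funext->. Qed.

End GeometricSums.

(** * Power series and local resolvents *)

Lemma scaler_swap (A : comPzRingType) (V : lmodType A) (a b : A) (v : V) :
  a *: (b *: v) = b *: (a *: v).
Proof. by rewrite !scalerA mulrC. Qed.

Section PowerSeries.
Variables (R : realType) (H : completeNormedModType R[i]).
Local Notation C := (R[i])^o.

Lemma power_term_le (z : nat -> H) (K q r : R) (a : C) m n :
  0 <= q -> rnorm a <= r -> (forall n, rnorm (z n) <= K * q ^+ n) ->
  rnorm (a ^+ n *: z (n + m)%N) <= K * q ^+ m * (q * r) ^+ n.
Proof.
move=> q0 ar zK; rewrite rnormZ rnormX mulrC.
rewrite (_ : K * _ * _ = K * q ^+ (n + m) * r ^+ n); last first.
  by rewrite exprMn exprD; ring.
apply: ler_pM; rewrite ?exprn_ge0 ?rnorm_ge0//.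
by rewrite lerXn2r ?nnegrE ?rnorm_ge0// (le_trans (rnorm_ge0 _) ar).
Qed.

(** The increment of a power series factors as [b - a] times another power
    series in [b], whose coefficients are the tails of the first one at [a]; the
    factor is again a power series, so the statement applies twice and gives
    differentiability without any estimate on derivatives of monomials. *)
Lemma power_series_increment (z : nat -> H) (K q r : R) (a : C) (s : H) :
  0 <= q -> q * r < 1 -> rnorm a <= r ->
  (forall n, rnorm (z n) <= K * q ^+ n) ->
  geom_sum (fun n => a ^+ n *: z n) s ->
  exists2 g : nat -> H, forall n, rnorm (g n) <= K * q / (1 - q * r) * q ^+ n &
    forall (b : C) (t w : H), rnorm b <= r ->
      geom_sum (fun n => b ^+ n *: z n) t ->
      geom_sum (fun n => b ^+ n *: g n) w -> t - s = (b - a) *: w.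
Proof.
move=> q0 qr1 ar zK zs.
have r0 : 0 <= r by apply: le_trans (rnorm_ge0 _) ar.
have qr0 : 0 <= q * r by rewrite mulr_ge0.
have /choice[G GP] m : exists t, geom_sum (fun n => a ^+ n *: z (n + m)%N) t /\
    rnorm t <= K * q ^+ m / (1 - q * r).
  have [t t1 t2] := geom_sum_exists qr0 qr1 (fun n => power_term_le m n q0 ar zK).
  by exists t.
have zG m : z m = G m - a *: G m.+1.
  apply/eqP; rewrite eq_sym subr_eq addrC -subr_eq; apply/eqP.
  have := geom_sum_shift (GP m).1; rewrite expr0 scale1r add0n.
  move/geom_sum_uniq; apply.
  apply: eq_geom_sum (geom_sum_scale a (GP m.+1).1) => n.
  by rewrite scalerA -exprS addSnnS.
have Gs : G 0%N = s.
  apply: geom_sum_uniq zs; apply: eq_geom_sum (GP 0%N).1 => n.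
  by rewrite addn0.
exists (fun n => G n.+1) => [n|b t w br zt Gw].
  by apply: le_trans (GP _).2 _; rewrite exprS (mulrAC _ _ (q ^+ n)) mulrA.
have GK n : rnorm (G n) <= K / (1 - q * r) * q ^+ n.
  by apply: le_trans (GP _).2 _; rewrite mulrAC.
have [A AG _] := geom_sum_exists qr0 qr1 (fun n => power_term_le 0 n q0 br GK).
have {}AG : geom_sum (fun n => b ^+ n *: G n) A.
  by apply: eq_geom_sum AG => n; rewrite addn0.
have As : A - s = b *: w.
  have := geom_sum_shift AG; rewrite expr0 scale1r Gs.
  move/geom_sum_uniq; apply.
  by apply: eq_geom_sum (geom_sum_scale b Gw) => n; rewrite scalerA -exprS.
have At : t = A - a *: w.
  apply: geom_sum_uniq zt _.
  apply: eq_geom_sum (geom_sumB AG (geom_sum_scale a Gw)) => n.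
  by rewrite zG scalerBr !scalerA mulrC.
by rewrite At addrAC As scalerBl.
Qed.

Lemma power_series_analytic (z : nat -> H) (K q : R) (c : C) :
  0 < q -> (forall n, rnorm (z n) <= K * q ^+ n) ->
  exists f : C -> H, forall l : C, rnorm (l - c) < q^-1 ->
    geom_sum (fun n => (l - c) ^+ n *: z n) (f l) /\ derivable f l 1.
Proof.
move=> q0 zK.
have ex (v : nat -> H) (K' r : R) (a : C) : rnorm a <= r -> q * r < 1 ->
    (forall n, rnorm (v n) <= K' * q ^+ n) ->
    exists2 t, geom_sum (fun n => a ^+ n *: v n) t & rnorm t <= K' / (1 - q * r).
  move=> ar qr1 vK; have qr0 : 0 <= q * r.
    by rewrite mulr_ge0 ?(ltW q0)// (le_trans (rnorm_ge0 _) ar).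
  have [t t1 t2] := geom_sum_exists qr0 qr1 (fun n => power_term_le 0 n (ltW q0) ar vK).
  exists t; last by rewrite expr0 mulr1 in t2.
  by apply: eq_geom_sum t1 => n; rewrite addn0.
have /choice[f fP] (l : C) : exists t, rnorm (l - c) < q^-1 ->
    geom_sum (fun n => (l - c) ^+ n *: z n) t.
  have [lq|lq] := pselect (rnorm (l - c) < q^-1); last by exists 0.
  have [|t t1 _] := @ex z K _ (l - c) (lexx _) _ zK.
    by rewrite mulrC -ltr_pdivlMr// div1r.
  by exists t.
exists f => l lq; split; first exact: fP.
pose r := (rnorm (l - c) + q^-1) / 2.
have lr : rnorm (l - c) < r by rewrite /r; move: lq; lra.
have qr1 : q * r < 1.
  by rewrite mulrC -ltr_pdivlMr// div1r /r; move: lq; lra.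
have [g gK gP] := power_series_increment (ltW q0) qr1 (ltW lr) zK (fP _ lq).
have [d dP _] := ex _ _ _ _ (ltW lr) qr1 gK.
have [g' g'K g'P] := power_series_increment (ltW q0) qr1 (ltW lr) gK dP.
set K2 := K * q / (1 - q * r) * q / (1 - q * r) in g'K.
apply: (@derivable_quadratic _ _ _ _ d (K2 / (1 - q * r)) (r - rnorm (l - c))).
  by rewrite subr_gt0.
move=> h hr.
have hlr : rnorm (h + l - c) <= r.
  rewrite -addrA (le_trans (rnormD _ _))// -lerBrDr ltW//.
have hlq : rnorm (h + l - c) < q^-1.
  by apply: le_lt_trans hlr _; rewrite -div1r ltr_pdivlMr// mulrC.
have [w wP _] := ex _ _ _ _ hlr qr1 gK.
have [w' w'P w'K] := ex _ _ _ _ hlr qr1 g'K.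
have hl : h + l - c - (l - c) = h by rewrite opprB addrA subrK addrK.
have := gP _ _ _ hlr (fP _ hlq) wP; rewrite hl => ->.
have := g'P _ _ _ hlr wP w'P; rewrite hl => e.
rewrite -scalerBr e scalerA rnormZ rnormM mulrC expr2.
by rewrite ler_wpM2r// mulr_ge0 ?rnorm_ge0.
Qed.

Lemma preimage_power_series (T : {linear H -> H}) (c l : C) (x f : H)
    (z : nat -> H) : bounded_operator T -> T (z 0%N) - c *: z 0%N = x ->
  (forall n, T (z n.+1) - c *: z n.+1 = z n) ->
  geom_sum (fun n => (l - c) ^+ n *: z n) f -> T f - l *: f = x.
Proof.
move=> bT z0 zS zf.
have := geom_sumB (geom_sum_linear bT zf) (geom_sum_scale c zf).
move=> /geom_sum_shift/=; rewrite expr0 scale1r z0 => /geom_sum_uniq e.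
have {e} : T f - c *: f - x = (l - c) *: f.
  apply: e; apply: eq_geom_sum (geom_sum_scale (l - c) zf) => n /=.
  by rewrite [T _]linearZ/= scalerA -exprS scaler_swap -scalerBr zS.
move/eqP; rewrite subr_eq => /eqP e.
by rewrite scalerBl addrAC in e; move: e => /addIr ->; rewrite addrAC subrr add0r.
Qed.

(** Dividing repeatedly by [T - c] at geometric cost produces the Taylor
    coefficients at [c] of a local resolvent function of [x]. *)
Lemma local_resolvent_of_iterated_preimages (T : {linear H -> H}) (c : C)
    (x : H) (z : nat -> H) (K q : R) (l : C) :
  bounded_operator T -> 0 < q -> (forall n, rnorm (z n) <= K * q ^+ n) ->
  T (z 0%N) - c *: z 0%N = x ->
  (forall n, T (z n.+1) - c *: z n.+1 = z n) ->
  rnorm (l - c) < q^-1 -> local_resolvent_set T x l.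
Proof.
move=> bT q0 zK z0 zS lq.
have [f fP] := power_series_analytic c q0 zK.
exists [set a : C | rnorm (a - c) < q^-1] => //; split.
  exact: open_rnorm_lt.
exists f => [a /fP[]//|a /fP[fa _]].
exact: preimage_power_series bT z0 zS fa.
Qed.

Lemma local_resolvent_preimage (T : H -> H) (x : H) (l : C) :
  local_resolvent_set T x l -> exists y, T y - l *: y = x.
Proof. by move=> [U [_ [f _ fP]] Ul]; exists (f l); exact: fP. Qed.

(** Outside the disc of the growth rate of [T ^ n x], the Neumann series divides
    [x] by [T - l] and keeps the growth rate, so that it can be iterated. *)
Lemma neumann_preimage (T : {linear H -> H}) (x : H) (K r : R) (l : C) :
  bounded_operator T -> 0 <= r -> r < rnorm l ->
  (forall n, rnorm (iter n T x) <= K * r ^+ n) ->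
  exists s, [/\ geom_sum (fun n => l^-1 ^+ n *: iter n T x) s,
    T (- l^-1 *: s) - l *: (- l^-1 *: s) = x
    & forall m, rnorm (iter m T (- l^-1 *: s)) <= K / (rnorm l - r) * r ^+ m].
Proof.
move=> bT r0 rl xK.
have l0 : 0 < rnorm l by apply: le_lt_trans rl.
have ln0 : l != 0 by rewrite -rnorm_gt0.
have q0 : 0 <= rnorm l^-1 * r by rewrite mulr_ge0 ?rnorm_ge0.
have q1 : rnorm l^-1 * r < 1 by rewrite rnormV mulrC ltr_pdivrMr// mul1r.
have uK m n : rnorm (l^-1 ^+ n *: iter m T (iter n T x)) <= K * r ^+ m * (rnorm l^-1 * r) ^+ n.
  rewrite rnormZ rnormX exprMn -iterD.
  apply: le_trans (ler_wpM2l _ (xK _)) _; first by rewrite exprn_ge0 ?rnorm_ge0.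
  by rewrite exprD le_eqVlt; apply/orP; left; apply/eqP; ring.
have sums m : exists2 t, geom_sum (fun n => l^-1 ^+ n *: iter m T (iter n T x)) t &
    rnorm t <= K * r ^+ m / (1 - rnorm l^-1 * r).
  exact: geom_sum_exists q0 q1 (uK m).
have [s sP _] := sums 0%N.
have iter_sums m : geom_sum (fun n => l^-1 ^+ n *: iter m T (iter n T x)) (iter m T s).
  elim: m => [//|m ih]; rewrite iterS.
  by apply: eq_geom_sum (geom_sum_linear bT ih) => n; rewrite /= linearZ.
exists s; split => //.
- have := geom_sum_shift sP; rewrite expr0 scale1r => /geom_sum_uniq h.
  have {h} e : s - x = l^-1 *: T s.
    apply: h; apply: eq_geom_sum (geom_sum_scale l^-1 (iter_sums 1%N)) => n.
    by rewrite scalerA -exprS.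
  by rewrite linearZ/= scalerA mulrN mulfV// scaleN1r opprK scaleNr -e opprB subrK.
- move=> m; have [t tP tK] := sums m.
  have -> : iter m T (- l^-1 *: s) = - l^-1 *: t.
    rewrite (geom_sum_uniq tP (iter_sums m)).
    by elim: m {tP tK t} => [//|m ih]; rewrite !iterS ih linearZ.
  rewrite rnormZ rnormN; apply: le_trans (ler_wpM2l (rnorm_ge0 _) tK) _.
  rewrite rnormV le_eqVlt; apply/orP; left; apply/eqP; field.
  by rewrite !gt_eqF// subr_gt0.
Qed.

Lemma local_resolvent_of_growth (T : {linear H -> H}) (x : H) (K r : R) (l : C) :
  bounded_operator T -> 0 <= r -> r < rnorm l ->
  (forall n, rnorm (iter n T x) <= K * r ^+ n) -> local_resolvent_set T x l.
Proof.
move=> bT r0 rl xK; pose c := (rnorm l - r)^-1.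
have c0 : 0 < c by rewrite invr_gt0 subr_gt0.
have /choice[g gP] (p : R * H) : exists y,
    (forall n, rnorm (iter n T p.2) <= p.1 * r ^+ n) ->
    T y - l *: y = p.2 /\ forall n, rnorm (iter n T y) <= p.1 * c * r ^+ n.
  have [h|h] := pselect (forall n, rnorm (iter n T p.2) <= p.1 * r ^+ n); last by exists 0.
  by have [s [_ s1 s2]] := neumann_preimage bT r0 rl h; exists (- l^-1 *: s).
pose st := fix st n := if n is m.+1 then ((st m).1 * c, g (st m)) else (K, x).
have stK n : (st n).1 = K * c ^+ n.
  by elim: n => [|n /= ->]; rewrite ?mulr1// exprSr mulrA.
have stP n : forall m, rnorm (iter m T (st n).2) <= (st n).1 * r ^+ m.
  by elim: n => [//|n /= /gP[]].
apply: (@local_resolvent_of_iterated_preimages T l x (fun n => (st n.+1).2) (K * c) c l) => //.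
- by move=> n; have := stP n.+1 0%N; rewrite stK mulr1 exprS mulrA.
- by have [] := gP _ (stP 0%N).
- by move=> n; have [] := gP _ (stP n.+1).
- by rewrite subrr rnorm0 invr_gt0.
Qed.

End PowerSeries.

(** * Open mapping *)

Section OpenMapping.
Variables (R : realType) (H : completeNormedModType R[i]).

(** Baire category in the form needed for the open mapping theorem, stated for
    an exhaustion of the space rather than for open sets: otherwise shrinking
    balls would avoid all the [A n], and so would their common point. *)
Lemma baire_exhaustion (A : nat -> set H) : (forall y, exists n, A n y) ->
  exists n a (r : R), 0 < r /\ forall y, rnorm (y - a) <= r ->
    forall d : R, 0 < d -> exists2 z, A n z & rnorm (z - y) < d.
Proof.
move=> covA; apply: contrapT => nA.
have step (p : nat * (H * R)) : exists p' : H * R, 0 < p.2.2 ->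
    [/\ 0 < p'.2, p'.2 <= p.2.2 / 2, rnorm (p'.1 - p.2.1) <= p.2.2 / 2
      & forall z, A p.1 z -> p'.2 < rnorm (z - p'.1)].
  have [r0|r0] := pselect (0 < p.2.2); last by exists (0, 0) => /r0.
  apply: contrapT => no; apply: nA; exists p.1, p.2.1, (p.2.2 / 2).
  split; first by rewrite divr_gt0.
  move=> y yr d d0; apply: contrapT => noz; apply: no.
  exists (y, Num.min (d / 2) (p.2.2 / 2)) => _ /=; split => //.
  - by rewrite lt_min !divr_gt0.
  - by rewrite ge_min lexx orbT.
  - move=> z Az; rewrite gt_min; apply/orP; left.
    rewrite ltNge; apply/negP => zd; apply: noz; exists z => //.
    by rewrite (le_lt_trans zd)// ltr_pdivrMr// ltr_pMr// ltr1n.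
have /choice[F FP] := step.
(* Balls as pairs of a centre and a radius; the ball of index [n.+1] avoids
   [A n] and has at most half the radius of the previous one. *)
pose st := fix st n := if n is m.+1 then F (m, st m) else (0 : H, 1 : R).
have st0 n : 0 < (st n).2.
  by elim: n => [|n /= ih]; [exact: ltr01|have [] := FP (n, st n) ih].
have stP n := FP (n, st n) (st0 n).
have nested N k : rnorm ((st (N + k)%N).1 - (st N).1) + (st (N + k)%N).2 <= (st N).2.
  elim: k => [|k]; first by rewrite addn0 subrr rnorm0 add0r.
  apply: le_trans; rewrite addnS.
  have [_ h1 h2 _] := stP (N + k)%N.
  have := rnorm_dist (st (N + k).+1).1 (st (N + k)%N).1 (st N).1.
  by move: h1 h2 => /=; lra.
have st_le n : (st n).2 <= 2^-1 ^+ n.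
  elim: n => [|n ih]; first by rewrite expr0.
  have [_ + _ _] := stP n; rewrite exprS => /le_trans; apply.
  by rewrite /= mulrC ler_wpM2l.
pose u n := (st n.+1).1 - (st n).1.
have [|//|n|s sP _] := @geom_sum_exists _ _ u 2^-1 2^-1.
- by rewrite invr_ge0.
- by rewrite invf_lt1// ltr1n.
- have [_ _ + _] := stP n; move/le_trans; apply.
  by rewrite /= mulrC ler_wpM2l.
have us N : \sum_(n < N) u n = (st N).1.
  elim: N => [|N ih]; first by rewrite big_ord0.
  by rewrite big_ord_recr/= ih /u addrC subrK.
have sN N : rnorm (s - (st N).1) <= (st N).2.
  apply/ler_addgt0Pr => e e0.
  have [K [q [q0 q1 sK]]] := sP.
  have [M /(_ (N + M)%N (leq_addl _ _)) hM] := geom_small K q0 q1 e0.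
  have := sK (N + M)%N; rewrite us => h1.
  have := nested N M; have := st0 (N + M)%N.
  have := rnorm_dist s (st (N + M)%N).1 (st N).1; lra.
have [n An] := covA s.
have [_ _ _ /(_ _ An)] := stP n.
by move=> /lt_le_trans/(_ (sN n.+1)); rewrite ltxx.
Qed.

(** For a surjective bounded operator, the images of balls are dense near the
    origin by category; correcting the error repeatedly gives exact preimages of
    controlled norm. *)
Lemma open_mapping (T : {linear H -> H}) : bounded_operator T ->
  (forall y, exists x, T x = y) ->
  exists2 c : R, 0 < c & forall y, exists2 x, T x = y & rnorm x <= c * rnorm y.
Proof.
move=> bT surj.
have [y|n [a [r [r0 ball]]]] := @baire_exhaustion
    (fun n => [set y | exists2 x, T x = y & rnorm x <= n%:R]).
  have [x Tx] := surj y; exists (Num.truncn (rnorm x)).+1 => /=.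
  by exists x => //; apply: ltW; rewrite truncnS_gt.
pose c0 : R := 2 * n%:R / r.
have c00 : 0 <= c0 by rewrite !mulr_ge0// invr_ge0 ltW.
have /choice[phi phiP] y : exists x, rnorm x <= c0 * rnorm y /\
    rnorm (y - T x) <= rnorm y / 2.
  have [->|y0] := eqVneq y 0.
    by exists 0; rewrite linear0 subr0 rnorm0 mulr0 mul0r.
  have ny0 : 0 < rnorm y by rewrite rnorm_gt0.
  have t0 : 0 < rnorm y / r by rewrite divr_gt0.
  set t := rnorm y / r in t0.
  (* [y] is rescaled to [y1] of norm [r]; as a difference of two points of the
     ball of centre [a], it is approximated by a difference of two images. *)
  pose y1 := (t%:C)^-1 *: y.
  have nt : rnorm t%:C = t by rewrite rnorm_pos// ltW.
  have tC : t%:C != 0 by rewrite -rnorm_gt0 nt.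
  have ny1 : rnorm y1 = r.
    by rewrite rnormZ rnormV nt /t invf_div divfK// gt_eqF.
  have r40 : 0 < r / 4 by rewrite divr_gt0.
  have [|_ [x1 <- x1n] h1] := ball (a + y1) _ _ r40.
    by rewrite addrC addKr ny1.
  have [|_ [x2 <- x2n] h2] := ball a _ _ r40.
    by rewrite subrr rnorm0 ltW.
  exists (t%:C *: (x1 - x2)); split.
    have -> : c0 * rnorm y = t * (n%:R * 2) by rewrite /c0 /t; ring.
    rewrite rnormZ nt ler_pM2l// (le_trans (rnormB _ _))//.
    by rewrite mulr_natr mulr2n lerD.
  have -> : y - T (t%:C *: (x1 - x2)) =
      t%:C *: ((T x2 - a) - (T x1 - (a + y1))).
    have -> : T x2 - a - (T x1 - (a + y1)) = y1 - (T x1 - T x2).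
      by rewrite !opprB !addrA subrK [T x2 + _]addrC.
    by rewrite linearZ/= linearB/= [RHS]scalerBr /y1 scalerA mulfV// scale1r.
  rewrite rnormZ nt.
  have h : rnorm (T x2 - a - (T x1 - (a + y1))) <= r / 2.
    by have := rnormB (T x2 - a) (T x1 - (a + y1)); move: h1 h2; lra.
  rewrite (le_trans (ler_wpM2l (ltW t0) h))// /t mulrA divfK// gt_eqF//.
pose e y n : H := iter n (fun v => v - T (phi v)) y.
have eS y k : e y k.+1 = e y k - T (phi (e y k)) by [].
have eK y k : rnorm (e y k) <= rnorm y * 2^-1 ^+ k.
  elim: k => [|k ih]; first by rewrite expr0 mulr1.
  rewrite eS (le_trans (phiP _).2)// exprSr mulrA ler_wpM2r//.
have h0 : 0 <= 2^-1 :> R by rewrite invr_ge0.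
have h1 : 2^-1 < 1 :> R by rewrite invf_lt1// ltr1n.
exists (c0 * 2 + 1); first by rewrite ltr_wpDl// mulr_ge0.
move=> y.
have [k|x xP xc] := @geom_sum_exists _ _ (fun k => phi (e y k)) (c0 * rnorm y) _ h0 h1.
  by rewrite -mulrA (le_trans (phiP _).1)// ler_wpM2l.
exists x; last first.
  apply: le_trans xc _; rewrite mulrDl mul1r.
  rewrite (_ : _ / _ = c0 * 2 * rnorm y); first by rewrite lerDl rnorm_ge0.
  by field.
apply: geom_sum_uniq (geom_sum_linear bT xP) _.
exists (rnorm y), 2^-1; split => // N.
have -> : y - \sum_(k < N) (T \o (fun k => phi (e y k))) k = e y N.
  elim: N => [|N ih]; first by rewrite big_ord0 subr0.
  by rewrite big_ord_recr opprD addrA ih eS.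
exact: eK.
Qed.

Lemma bijective_invertible (T : {linear H -> H}) : bounded_operator T ->
  (forall y, exists x, T x = y) -> (forall x, T x = 0 -> x = 0) ->
  invertible T.
Proof.
move=> bT surj inj.
have injT : injective T.
  by move=> x y Txy; apply/eqP; rewrite -subr_eq0; apply/eqP/inj; rewrite linearB/= Txy subrr.
have [c c0 cP] := open_mapping bT surj.
have /choice[g gP] y : exists x, T x = y /\ rnorm x <= c * rnorm y.
  by have [x] := cP y; exists x.
have Tg y : T (g y) = y by have [] := gP y.
have ling : linear g by move=> a x y; apply: injT; rewrite linearP/= !Tg.
pose G : {linear H -> H} := HB.pack g (GRing.isLinear.Build _ _ _ _ g ling).
exists G; split.
- by exists c => y; have [] := gP y.
- by move=> x; apply: injT; rewrite /= Tg.
- exact: Tg.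
Qed.

End OpenMapping.

(** * Exponential growth and limits of roots *)

Section RootGrowth.
Variable R : realType.
Implicit Types (b u : nat -> R) (r K : R).

Lemma root_exprn (x : R) n : 0 <= x -> (0 < n)%N -> (x `^ n%:R^-1) ^+ n = x.
Proof.
move=> x0 n0; rewrite -powR_mulrn ?powR_ge0// -powRrM mulVf ?powRr1//.
by rewrite pnatr_eq0 -lt0n.
Qed.

Lemma root_le (x r : R) n : 0 <= x -> 0 <= r -> (0 < n)%N ->
  (x `^ n%:R^-1 <= r) = (x <= r ^+ n).
Proof.
by move=> x0 r0 n0; rewrite -[in RHS](root_exprn x0 n0) ler_pXn2r ?nnegrE ?powR_ge0.
Qed.

Lemma root_ge (x r : R) n : 0 <= x -> 0 <= r -> (0 < n)%N ->
  (r <= x `^ n%:R^-1) = (r ^+ n <= x).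
Proof.
by move=> x0 r0 n0; rewrite -[in RHS](root_exprn x0 n0) ler_pXn2r ?nnegrE ?powR_ge0.
Qed.

Section BoundedSequence.
Variables (u : nat -> R) (M : R).
Hypothesis uM : forall n, 0 <= u n <= M.

Let bu : bounded_fun u.
Proof.
exists M; split; first exact: num_real.
move=> x Mx n _; have /andP[u0 /le_trans] := uM n.
by rewrite /= ger0_norm//; apply; exact: ltW.
Qed.

Let sdrop_ub n : has_ubound (sdrop u n).
Proof. by exists M => _ [m _ <-]; have /andP[] := uM m. Qed.

Let sdrop_lb n : has_lbound (sdrop u n).
Proof. by exists 0 => _ [m _ <-]; have /andP[] := uM m. Qed.

Let sdrop_neq0 n : sdrop u n !=set0.
Proof. by exists (u n), n => /=. Qed.

Lemma limn_sup_le r N : (forall n, (N <= n)%N -> u n <= r) -> limn_sup u <= r.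
Proof.
move=> h; rewrite limn_supE//; apply: (@le_trans _ _ (sups u N)).
  apply: ge_inf; last by exists N.
  exact: bounded_fun_has_lbound_sups.
by apply: ge_sup => // _ [m Nm <-]; exact: h.
Qed.

Lemma limn_sup_lt r : limn_sup u < r ->
  exists N, forall n, (N <= n)%N -> u n <= r.
Proof.
rewrite limn_supE// => /inf_lt -[|_ [N _ <-] hN].
  by exists (sups u 0%N), 0%N.
exists N => n Nn; apply: le_trans (ltW hN).
by apply: ub_le_sup => //; exists n.
Qed.

Let infs_ub : has_ubound (range (infs u)).
Proof.
exists M => _ [n _ <-]; have /andP[_] := uM n; apply: le_trans.
by apply: ge_inf => //; exists n => /=.
Qed.

Lemma limn_inf_ge r N : (forall n, (N <= n)%N -> r <= u n) -> r <= limn_inf u.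
Proof.
move=> h; rewrite limn_infE//; apply: (@le_trans _ _ (infs u N)).
  by apply: lb_le_inf => // _ [m Nm <-]; exact: h.
by apply: ub_le_sup => //; exists N.
Qed.

Lemma limn_inf_gt r : r < limn_inf u ->
  exists N, forall n, (N <= n)%N -> r <= u n.
Proof.
rewrite limn_infE// => /sup_gt -[|_ [N _ <-] hN].
  by exists (infs u 0%N), 0%N.
exists N => n Nn; apply: le_trans (ltW hN) _.
by apply: ge_inf => //; exists n.
Qed.

Lemma limn_sup_ge0 : 0 <= limn_sup u.
Proof.
rewrite leNgt; apply/negP => h.
have [|N /(_ N (leqnn _))] := @limn_sup_lt (limn_sup u / 2); first by lra.
by have /andP[] := uM N; lra.
Qed.

End BoundedSequence.

Lemma eventually_le_geometric b r N : 0 < r -> (forall n, 0 < b n) ->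
  (forall n, (N <= n)%N -> b n <= r ^+ n) ->
  exists2 K, 0 < K & forall n, b n <= K * r ^+ n.
Proof.
move=> r0 b0 h; pose K := 1 + \sum_(n < N) b n / r ^+ n.
have bK0 n : 0 <= b n / r ^+ n by rewrite ltW// divr_gt0 ?exprn_gt0.
have K1 : 1 <= K by rewrite lerDl sumr_ge0.
exists K => [|n]; first exact: lt_le_trans K1.
have [Nn|nN] := leqP N n.
  by apply: le_trans (h _ Nn) _; rewrite ler_peMl ?exprn_ge0 ?(ltW r0).
rewrite -ler_pdivrMr ?exprn_gt0//.
by rewrite /K (bigD1 (Ordinal nN))//= addrCA lerDl addr_ge0// sumr_ge0.
Qed.

(** The limits of [n]-th roots are used only through the exponential bounds that
    they encode. *)
Section Growth.
Variables (b : nat -> R) (M : R).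
Hypothesis b_gt0 : forall n, 0 < b n.
Hypothesis M_ge1 : 1 <= M.
Hypothesis bM : forall n, b n <= M ^+ n.

Local Notation root := (fun n : nat => b n `^ n%:R^-1).

Let M0 : 0 <= M. Proof. exact: le_trans M_ge1. Qed.

Let root_bounded n : 0 <= root n <= M.
Proof.
rewrite powR_ge0/=; case: n => [|n]; first by rewrite invr0 powRr0.
by rewrite root_le ?bM// ltW.
Qed.

Lemma limn_sup_root_ge0 : 0 <= limn_sup root.
Proof. exact: limn_sup_ge0 root_bounded. Qed.

Lemma limn_inf_root_ge0 : 0 <= limn_inf root.
Proof.
apply: (limn_inf_ge root_bounded (N := 0%N)) => n _.
by have /andP[] := root_bounded n.
Qed.

(** A constant factor disappears in the limit of roots. The index 0 is left out
    in the proof because the exponent [0^-1] is 0. *)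
Lemma limn_sup_root_le r K : 0 < r -> (forall n, b n <= K * r ^+ n) ->
  limn_sup root <= r.
Proof.
move=> r0 bK; rewrite leNgt; apply/negP => h.
set L := limn_sup root in h; pose r' := (L + r) / 2.
have rr' : r < r' by rewrite /r'; lra.
have r'0 : 0 < r' by lra.
have q1 : r / r' < 1 by rewrite ltr_pdivrMr// mul1r.
have q0 : 0 <= r / r' by rewrite ltW// divr_gt0.
have [N hN] := geom_small K q0 q1 ltr01.
suff : L <= r' by rewrite /r'; lra.
apply: (limn_sup_le root_bounded (N := N.+1)) => -[//|n] Nn.
rewrite root_le ?(ltW r'0) ?(ltW (b_gt0 _))//.
apply: le_trans (bK _) _; rewrite -[leRHS]mul1r -ler_pdivrMr ?exprn_gt0//.
by rewrite -mulrA -expr_div_n ltW// hN// ltnW.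
Qed.

Lemma limn_inf_root_ge r K : 0 < r -> 0 < K ->
  (forall n, r ^+ n <= K * b n) -> r <= limn_inf root.
Proof.
move=> r0 K0 bK; rewrite leNgt; apply/negP => h.
have := limn_inf_root_ge0.
set L := limn_inf root in h *; pose r' := (L + r) / 2 => L0.
have rr' : r' < r by rewrite /r'; lra.
have r'0 : 0 < r' by rewrite /r'; lra.
have q1 : r' / r < 1 by rewrite ltr_pdivrMr// mul1r.
have q0 : 0 <= r' / r by rewrite ltW// divr_gt0.
have [N hN] := geom_small K q0 q1 ltr01.
suff : r' <= L by rewrite /r'; lra.
apply: (limn_inf_ge root_bounded (N := N.+1)) => -[//|n] Nn.
rewrite root_ge ?(ltW r'0) ?(ltW (b_gt0 _))//.
have /ltW := hN n.+1 (ltnW Nn).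
rewrite expr_div_n mulrA ler_pdivrMr ?exprn_gt0// mul1r => /le_trans/(_ (bK _)).
by rewrite ler_pM2l.
Qed.

Lemma limn_sup_root_lt r : limn_sup root < r ->
  exists2 K, 0 < K & forall n, b n <= K * r ^+ n.
Proof.
move=> h; have r0 : 0 < r by apply: le_lt_trans h; exact: limn_sup_root_ge0.
have [N hN] := limn_sup_lt root_bounded h.
apply: (@eventually_le_geometric _ _ N.+1) => // -[//|n] Nn.
by rewrite -root_le ?(ltW r0) ?(ltW (b_gt0 _))// hN// ltnW.
Qed.

Lemma limn_inf_root_gt r : 0 < r -> r < limn_inf root ->
  exists2 K, 0 < K & forall n, r ^+ n <= K * b n.
Proof.
move=> r0 h.
have [N hN] := limn_inf_gt root_bounded h.
have [||n Nn|K K0 hK] := @eventually_le_geometric (fun n => (b n)^-1) r^-1 N.+1.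
- by rewrite invr_gt0.
- by move=> n; rewrite invr_gt0.
- case: n Nn => // n Nn.
  rewrite exprVn lef_pV2 ?posrE ?exprn_gt0//.
  by rewrite -root_ge ?(ltW r0) ?(ltW (b_gt0 _))// hN// ltnW.
exists K => // n; have := hK n.
by rewrite exprVn -ler_pdivrMr ?invr_gt0 ?exprn_gt0// invrK mulrC ler_pdivrMr.
Qed.

End Growth.
End RootGrowth.

(** * Products of weights *)

Section Weights.
Variables (R : realType) (w : int -> R).
Hypothesis w_gt0 : forall n, 0 < w n.

Definition fwdprod (k : int) (n : nat) : R := \prod_(i < n) w (k + i%:Z).
Definition bwdprod (k : int) (n : nat) : R := \prod_(i < n) w (k - i.+1%:Z).

Lemma fwdprod0 k : fwdprod k 0 = 1. Proof. by rewrite /fwdprod big_ord0. Qed.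
Lemma bwdprod0 k : bwdprod k 0 = 1. Proof. by rewrite /bwdprod big_ord0. Qed.

Lemma fwdprodS k n : fwdprod k n.+1 = w k * fwdprod (k + 1) n.
Proof.
rewrite /fwdprod big_ord_recl/= addr0; congr (_ * _).
by apply: eq_bigr => i _; rewrite -addrA -intS.
Qed.

Lemma fwdprodSr k n : fwdprod k n.+1 = fwdprod k n * w (k + n%:Z).
Proof. by rewrite /fwdprod big_ord_recr. Qed.

Lemma bwdprodS k n : bwdprod (k + 1) n.+1 = w k * bwdprod k n.
Proof.
rewrite /bwdprod big_ord_recl/= addrK; congr (_ * _).
by apply: eq_bigr => i _; rewrite /bump/= (intS i.+1) opprD addrA addrK.
Qed.

Lemma bwdprodSr k n : bwdprod k n.+1 = bwdprod k n * w (k - n.+1%:Z).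
Proof. by rewrite /bwdprod big_ord_recr. Qed.

Lemma fwdprod_bwdprod k n : fwdprod k n = bwdprod (k + n%:Z) n.
Proof.
elim: n => [|n ih]; first by rewrite fwdprod0 bwdprod0.
by rewrite fwdprodSr ih (_ : k + n.+1%:Z = k + n%:Z + 1) ?bwdprodS 1?mulrC// -addrA -PoszD addn1.
Qed.

Lemma fwdprod_gt0 k n : 0 < fwdprod k n.
Proof. by apply: prodr_gt0 => i _. Qed.

Lemma bwdprod_gt0 k n : 0 < bwdprod k n.
Proof. by apply: prodr_gt0 => i _. Qed.

Lemma bwdprod_inv_le k (r K : R) n : 0 < r ->
  (forall m, r ^+ m <= K * bwdprod k m) -> (bwdprod k n)^-1 <= K * r^-1 ^+ n.
Proof.
move=> r0 hK; have b0 := bwdprod_gt0 k n.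
by rewrite exprVn ler_pdivlMr ?exprn_gt0// mulrC ler_pdivrMr.
Qed.

Lemma int_shift_invariant (P : int -> Prop) :
  (forall k, P k <-> P (k + 1)) -> forall j k, P j -> P k.
Proof.
move=> Pk; have from0 k : P 0 <-> P k.
  elim/int_ind : k => [//|n [h1 h2]|n [h1 h2]].
    rewrite -addn1 PoszD; by split => [/h1 /(Pk _).1|/(Pk _).2 /h2].
  have e : - n.+1%:Z + 1 = - n%:Z by rewrite -addn1 PoszD opprD subrK.
  have := Pk (- n.+1%:Z); rewrite e => -[h3 h4].
  by split => [/h1/h4|/h3/h2].
by move=> j k /(from0 _).2 /(from0 _).1.
Qed.

(** Changing the base point of the products costs one weight, so exponential
    bounds at one base point hold at all of them. *)
Lemma fwdprod_growth_base (r : R) (j k : int) : 0 < r ->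
  (exists2 K, 0 < K & forall n, fwdprod j n <= K * r ^+ n) ->
  exists2 K, 0 < K & forall n, fwdprod k n <= K * r ^+ n.
Proof.
move=> r0; move: j k; apply: int_shift_invariant => k; split => -[K K0 hK].
  exists (K * r / w k) => [|n]; first by rewrite divr_gt0// mulr_gt0.
  have := hK n.+1; rewrite fwdprodS exprS -ler_pdivlMl// => /le_trans; apply.
  by rewrite le_eqVlt; apply/orP; left; apply/eqP; ring.
have K'0 : 0 < w k * K / r by rewrite divr_gt0// mulr_gt0.
exists (1 + w k * K / r) => [|[|n]]; first by rewrite addr_gt0.
  by rewrite fwdprod0 expr0 mulr1 lerDl ltW.
rewrite fwdprodS mulrDl; apply: ler_wpDl; first by rewrite mul1r exprn_ge0// ltW.
rewrite exprS mulrA divfK ?gt_eqF// -mulrA ler_pM2l//.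
Qed.

Lemma bwdprod_growth_base (r : R) (j k : int) : 0 < r ->
  (exists2 K, 0 < K & forall n, r ^+ n <= K * bwdprod j n) ->
  exists2 K, 0 < K & forall n, r ^+ n <= K * bwdprod k n.
Proof.
move=> r0; move: j k; apply: int_shift_invariant => k; split => -[K K0 hK].
  have K'0 : 0 < r * K / w k by rewrite divr_gt0// mulr_gt0.
  exists (1 + r * K / w k) => [|[|n]]; first by rewrite addr_gt0.
    by rewrite bwdprod0 expr0 mulr1 lerDl ltW.
  rewrite bwdprodS mulrDl; apply: ler_wpDl.
    by rewrite mul1r ltW// mulr_gt0// bwdprod_gt0.
  by rewrite exprS mulrA divfK ?gt_eqF// -mulrA ler_pM2l.
exists (K * w k / r) => [|n]; first by rewrite divr_gt0// mulr_gt0.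
have := hK n.+1; rewrite bwdprodS exprS -ler_pdivlMl// => /le_trans; apply.
by rewrite le_eqVlt; apply/orP; left; apply/eqP; ring.
Qed.

Lemma beta_fwdprod n : beta w n%:Z = fwdprod 0 n.
Proof. by apply: eq_bigr => i _; rewrite add0r. Qed.

Lemma beta_bwdprod n : (beta w (- n%:Z))^-1 = bwdprod 0 n.
Proof.
case: n => [|n]; first by rewrite oppr0 bwdprod0 /= big_ord0 invr1.
rewrite -NegzE /= invrK.
by apply: eq_bigr => i _; rewrite sub0r NegzE.
Qed.

Section BoundedWeights.
Variable M : R.
Hypothesis wM : forall n, w n <= M.
Let M1 := Num.max 1 M.
Let M1_ge1 : 1 <= M1. Proof. by rewrite le_max lexx. Qed.
Let prodM (f : nat -> int) n : \prod_(i < n) w (f i) <= M1 ^+ n.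
Proof.
rewrite -[X in _ ^+ X](card_ord n) -prodr_const; apply: ler_prod => i _.
by rewrite ltW//= le_max wM orbT.
Qed.

Lemma r3_plusE : r3_plus w = limn_sup (fun n => fwdprod 0 n `^ n%:R^-1).
Proof.
by rewrite /r3_plus; congr limn_sup; apply/funext => n; rewrite beta_fwdprod.
Qed.

Lemma r2_minusE : r2_minus w = limn_inf (fun n => bwdprod 0 n `^ n%:R^-1).
Proof.
by rewrite /r2_minus; congr limn_inf; apply/funext => n; rewrite beta_bwdprod.
Qed.

Let fM n : fwdprod 0 n <= M1 ^+ n. Proof. exact: (prodM (fun i => 0 + i%:Z)). Qed.
Let bM n : bwdprod 0 n <= M1 ^+ n.
Proof. exact: (prodM (fun i => 0 - i.+1%:Z)). Qed.

Lemma r3_plus_ge0 : 0 <= r3_plus w.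
Proof. by rewrite r3_plusE; exact: limn_sup_root_ge0 (fwdprod_gt0 0) M1_ge1 fM. Qed.

Lemma r2_minus_ge0 : 0 <= r2_minus w.
Proof. by rewrite r2_minusE; exact: limn_inf_root_ge0 (bwdprod_gt0 0) M1_ge1 bM. Qed.

Lemma r3_plus_le (k : int) (r K : R) : 0 < r -> 0 < K ->
  (forall n, fwdprod k n <= K * r ^+ n) -> r3_plus w <= r.
Proof.
move=> r0 K0 hK.
have [|K' _ K'P] := @fwdprod_growth_base r k 0 r0; first by exists K.
by rewrite r3_plusE; exact: (limn_sup_root_le (fwdprod_gt0 0) M1_ge1 fM r0 K'P).
Qed.

Lemma r3_plus_lt (k : int) (r : R) : r3_plus w < r ->
  exists2 K, 0 < K & forall n, fwdprod k n <= K * r ^+ n.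
Proof.
move=> h; apply: (@fwdprod_growth_base r 0).
  exact: le_lt_trans r3_plus_ge0 h.
by rewrite r3_plusE in h; exact: (limn_sup_root_lt (fwdprod_gt0 0) M1_ge1 fM h).
Qed.

Lemma r2_minus_ge (k : int) (r K : R) : 0 < r -> 0 < K ->
  (forall n, r ^+ n <= K * bwdprod k n) -> r <= r2_minus w.
Proof.
move=> r0 K0 hK.
have [|K' K'0 K'P] := @bwdprod_growth_base r k 0 r0; first by exists K.
by rewrite r2_minusE; exact: (limn_inf_root_ge (bwdprod_gt0 0) M1_ge1 bM r0 K'0 K'P).
Qed.

Lemma r2_minus_gt (k : int) (r : R) : 0 < r -> r < r2_minus w ->
  exists2 K, 0 < K & forall n, r ^+ n <= K * bwdprod k n.
Proof.
move=> r0 h; apply: (@bwdprod_growth_base r 0) => //.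
by rewrite r2_minusE in h; exact: (limn_inf_root_gt (bwdprod_gt0 0) M1_ge1 bM r0 h).
Qed.

End BoundedWeights.
End Weights.

(** * Orthonormal bases *)

Section Operators.
Variables (R : realType) (H : completeNormedModType R[i]).

Lemma bounded_operator_ge1 (T : H -> H) : bounded_operator T ->
  exists2 M : R, 1 <= M & forall x, rnorm (T x) <= M * rnorm x.
Proof.
move=> [M TM]; exists (Num.max 1 M) => [|x]; first by rewrite le_max lexx.
by apply: le_trans (TM x) _; rewrite ler_wpM2r ?rnorm_ge0// le_max lexx orbT.
Qed.

Lemma iter_le (T : H -> H) (M : R) n x : 0 <= M ->
  (forall y, rnorm (T y) <= M * rnorm y) ->
  rnorm (iter n T x) <= M ^+ n * rnorm x.
Proof.
move=> M0 TM; elim: n => [|n ih]; first by rewrite expr0 mul1r.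
by rewrite iterS (le_trans (TM _))// exprS -mulrA ler_wpM2l.
Qed.

Lemma iter_linear (T : {linear H -> H}) n (a : R[i]) (x y : H) :
  iter n T (a *: x + y) = a *: iter n T x + iter n T y.
Proof. by elim: n => [//|n ih]; rewrite !iterS ih linearP. Qed.

Lemma iter_linearB (T : {linear H -> H}) n (x y : H) :
  iter n T (x - y) = iter n T x - iter n T y.
Proof. by rewrite addrC -scaleN1r iter_linear scaleN1r addrC. Qed.

Lemma iter_linear_sum (T : {linear H -> H}) n (c : int -> R[i]) (f : int -> H)
    (s : seq int) :
  iter n T (\sum_(i <- s) c i *: f i) = \sum_(i <- s) c i *: iter n T (f i).
Proof.
elim: s => [|i s ih]; last by rewrite !big_cons iter_linear ih.
by rewrite !big_nil; elim: n => [//|n ih]; rewrite iterS ih linear0.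
Qed.

End Operators.

Section OrthonormalBasis.
Variables (R : realType) (H : completeNormedModType R[i]).
Variables (dot : {dot H for Num.conj}) (hdot : hilbert_norm dot).
Variables (e : int -> H) (he : orthonormal_basis dot e).

Lemma dot_e i j : dot (e i) (e j) = (i == j)%:R.
Proof. by case: he => h _; rewrite h. Qed.

Lemma dot_rnorm x : dot x x = (rnorm x ^+ 2)%:C.
Proof. by rewrite -hdot rnormE rmorphXn. Qed.

Lemma rnorm_e k : rnorm (e k) = 1.
Proof.
have /eqP : (rnorm (e k) ^+ 2)%:C = 1%:C by rewrite -dot_rnorm dot_e eqxx.
rewrite (inj_eq (@complexI R)) sqrf_eq1 => /orP[/eqP//|/eqP h].
by have := rnorm_ge0 (e k); rewrite h oppr_ge0 ler10.
Qed.

Lemma basis_approx x (d : R) : 0 < d ->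
  exists (s : seq int) (c : int -> R[i]), rnorm (x - \sum_(i <- s) c i *: e i) < d.
Proof.
move=> d0; have [_ [s [c ->]] xs] := dense_rnorm x he.2 d0.
by exists s, c.
Qed.

Lemma pythagoras (x y : H) : dot x y = 0 ->
  rnorm (x + y) ^+ 2 = rnorm x ^+ 2 + rnorm y ^+ 2.
Proof.
by move=> xy; apply: complexI; rewrite rmorphD/= -!dot_rnorm hnormDd.
Qed.

Lemma coord_le x k : rnorm (dot x (e k)) <= rnorm x.
Proof.
set a := dot x (e k).
have ort : dot (x - a *: e k) (a *: e k) = 0.
  by rewrite linearZr_LR linearBl linearZl_LR/= dot_e eqxx mulr1 subrr mulr0.
have := pythagoras ort; rewrite subrK => h.
rewrite -(@ler_pXn2r _ 2)// ?nnegrE ?rnorm_ge0// h rnormZ rnorm_e mulr1.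
by rewrite lerDr sqr_ge0.
Qed.

Lemma coord_eq0 x : (forall k, dot x (e k) = 0) -> x = 0.
Proof.
move=> xe; apply: rnorm_le0; apply/ler_addgt0Pr => d d0; rewrite add0r.
have [s [c xs]] := basis_approx x d0.
apply: le_trans (ltW xs); rewrite -(@ler_pXn2r _ 2)// ?nnegrE ?rnorm_ge0//.
rewrite pythagoras ?lerDl ?sqr_ge0// linearNr linear_sumr big1 ?oppr0// => i _.
by rewrite linearZr_LR/= xe mulr0.
Qed.

Lemma rnorm_comb (s : seq int) (c : int -> R[i]) : uniq s ->
  rnorm (\sum_(i <- s) c i *: e i) ^+ 2 = \sum_(i <- s) rnorm (c i) ^+ 2.
Proof.
elim: s => [|i s ih] /=; first by rewrite !big_nil rnorm0 expr0n.
move=> /andP[is_ us]; rewrite !big_cons pythagoras ?ih ?rnormZ ?rnorm_e ?mulr1//.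
rewrite linear_sumr big_seq big1// => j js.
rewrite linearZr_LR linearZl_LR/= dot_e; case: eqVneq js is_ => [->|_] //.
  by move=> ->.
by rewrite !mulr0.
Qed.

Lemma comb_undup (f : int -> H) (s : seq int) (c : int -> R[i]) :
  \sum_(i <- s) c i *: f i =
  \sum_(i <- undup s) (c i *+ count_mem i s) *: f i.
Proof.
rewrite -big_undup_iterop_count; apply: eq_bigr => i _.
by rewrite -[iterop _ _ _ _]/(_ *+ _) scalerMnl.
Qed.

End OrthonormalBasis.

(** * Resolvents, minimum modulus and spectral radius *)

Section ShiftedOperator.
Variables (R : realType) (H : completeNormedModType R[i]).

Definition shift_by (T : {linear H -> H}) (l : R[i]) (x : H) : H := T x - l *: x.

Lemma shift_by_is_linear T l : linear (shift_by T l).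
Proof.
move=> a x y; rewrite /shift_by linearP/= scalerDr opprD addrACA; congr (_ + _).
by rewrite scaler_swap -scalerBr.
Qed.

HB.instance Definition _ T l :=
  GRing.isLinear.Build _ _ _ _ (shift_by T l) (shift_by_is_linear T l).

Lemma shift_by_bounded (T : {linear H -> H}) l :
  bounded_operator T -> bounded_operator (shift_by T l).
Proof.
move=> [M TM]; exists (M + rnorm l) => x.
by rewrite (le_trans (rnormB _ _))// mulrDl rnormZ lerD2r.
Qed.

Lemma bijective_resolvent (T : {linear H -> H}) (l : R[i]) : bounded_operator T ->
  (forall y, exists x, T x - l *: x = y) ->
  (forall x, T x = l *: x -> x = 0) -> invertible (fun x => T x - l *: x).
Proof.
move=> bT surj inj.
apply: (@bijective_invertible _ _ (shift_by T l)) => //.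
  exact: shift_by_bounded.
by move=> x /eqP; rewrite subr_eq0 => /eqP/inj.
Qed.

Lemma invertible_preimage (T : H -> H) : invertible T ->
  exists2 c : R, 0 < c & forall y, exists2 x, T x = y & rnorm x <= c * rnorm y.
Proof.
move=> [G [bG _ TG]]; have [c c1 Gc] := bounded_operator_ge1 bG.
exists c => [|y]; first exact: lt_le_trans c1.
by exists (G y); [exact: TG|exact: Gc].
Qed.

Lemma invertible_lower_bound (T : H -> H) : invertible T ->
  exists2 c : R, 0 < c & forall x, rnorm x <= c * rnorm (T x).
Proof.
move=> [G [bG GT _]]; have [c c1 Gc] := bounded_operator_ge1 bG.
exists c => [|x]; first exact: lt_le_trans c1.
by rewrite -{1}(GT x).
Qed.

(** If [T - l] is onto with constant [c], then nearby bijective [T - m] are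
    bounded below by a constant depending on [c] only: a preimage under [T - l]
    is an approximate preimage under [T - m], and a lower bound for [T - m]
    improves to the fixed point of [g |-> c + g / 2]. *)
Lemma uniform_lower_bound (T : {linear H -> H}) (l m : R[i]) (c : R) :
  0 < c -> (forall y, exists2 x, T x - l *: x = y & rnorm x <= c * rnorm y) ->
  invertible (fun x => T x - m *: x) -> c * rnorm (m - l) <= 2^-1 ->
  forall x, rnorm x <= (2 * c + 1) * rnorm (T x - m *: x).
Proof.
move=> c0 surj /invertible_lower_bound[g g0 gP] cml.
pose P (h : R) := forall x, rnorm x <= h * rnorm (T x - m *: x).
have improve h : 0 <= h -> P h -> P (c + h / 2).
  move=> h0 hP x; set y := T x - m *: x.
  have [u uy uc] := surj y.
  have xu : T (x - u) - m *: (x - u) = (m - l) *: u.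
    have -> : T (x - u) - m *: (x - u) = y - (T u - m *: u).
      exact: (linearB (shift_by T m) x u).
    by rewrite -uy opprB addrC addrA subrK scalerBl.
  have := rnormD (x - u) u; rewrite subrK => /le_trans; apply.
  have h1 := hP (x - u); rewrite xu rnormZ in h1.
  have h2 : h * (rnorm (m - l) * rnorm u) <= h / 2 * rnorm y.
    rewrite -mulrA ler_wpM2l//.
    apply: le_trans (ler_wpM2l (rnorm_ge0 _) uc) _.
    by rewrite mulrA ler_wpM2r ?rnorm_ge0// mulrC.
  by rewrite mulrDl addrC lerD// (le_trans h1).
have h01 : 0 <= 2^-1 :> R by rewrite invr_ge0.
have iterP n : P (2 * c + g * 2^-1 ^+ n).
  elim: n => [|n ih] x.
    rewrite expr0 mulr1 (le_trans (gP x))// ler_wpM2r ?rnorm_ge0// lerDr.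
    by rewrite mulr_ge0// ltW.
  rewrite (_ : _ + _ = c + (2 * c + g * 2^-1 ^+ n) / 2).
    apply: improve => //; rewrite addr_ge0// mulr_ge0 ?exprn_ge0//; exact: ltW.
  by rewrite exprS; field.
have h11 : 2^-1 < 1 :> R by rewrite invf_lt1// ltr1n.
have [N /(_ N (leqnn _)) /ltW hN] := geom_small g h01 h11 ltr01.
by move=> x; apply: le_trans (iterP N x) _; rewrite ler_wpM2r ?rnorm_ge0// lerD2l.
Qed.

(** [T' - l^-1 = - l^-1 T' (T - l)] when [T'] is the inverse of [T]. *)
Lemma invertible_inverse_shift (T T' : {linear H -> H}) (l : R[i]) :
  bounded_operator T -> cancel T T' -> cancel T' T -> l != 0 ->
  invertible (fun x => T' x - l^-1 *: x) -> invertible (fun x => T x - l *: x).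
Proof.
move=> bT TK T'K l0 inv; apply: bijective_resolvent => // [y|x Tx].
  have [_ _ /(_ (- l^-1 *: T' y))[x xy _]] := invertible_preimage inv.
  have e : x - l^-1 *: T x = - l^-1 *: y.
    by have := congr1 T xy; rewrite linearB/= !linearZ/= !T'K.
  exists x; have -> : T x - l *: x = - l *: (x - l^-1 *: T x).
    by rewrite [RHS]scalerBr scalerA mulNr mulfV// scaleN1r opprK addrC scaleNr.
  by rewrite e scalerA mulrNN mulfV// scale1r.
have [c _ h] := invertible_lower_bound inv.
apply: rnorm_le0; apply: le_trans (h x) _.
have -> : T' x - l^-1 *: x = 0; last by rewrite rnorm0 mulr0.
by rewrite -[in X in _ *: X](TK x) Tx [T' _ in X in _ - X]linearZ/= scalerA mulVf// scale1r subrr.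
Qed.

End ShiftedOperator.

Section MinModulus.
Variables (R : realType) (H : completeNormedModType R[i]) (T : H -> H).

Lemma min_modulus_le (x : H) : rnorm x = 1 -> min_modulus T <= rnorm (T x).
Proof.
move=> x1; apply: ge_inf; last by exists x.
by exists 0 => _ [y _ <-]; exact: rnorm_ge0.
Qed.

Lemma min_modulus_ge (x : H) (K : R) : rnorm x = 1 ->
  (forall y, K * rnorm y <= rnorm (T y)) -> K <= min_modulus T.
Proof.
move=> x1 hK; apply: lb_le_inf; first by exists (rnorm (T x)), x.
by move=> _ [y /= y1 <-]; have := hK y; rewrite y1 mulr1.
Qed.

Lemma min_modulus_ge0 (x : H) : rnorm x = 1 -> 0 <= min_modulus T.
Proof.
by move=> x1; apply: (min_modulus_ge x1) => y; rewrite mul0r rnorm_ge0.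
Qed.

End MinModulus.

Section SpectralRadius.
Variables (R : realType) (H : completeNormedModType R[i]) (T : H -> H).

Lemma spectral_radius_ge0 : 0 <= spectral_radius T.
Proof.
rewrite /spectral_radius; set A := [set _ | _ in _].
(* [sup] is 0 on a set that is empty or unbounded. *)
have [hs|/sup_out->//] := pselect (has_sup A).
have [_ [l lT _]] := hs.1.
apply: le_trans (rnorm_ge0 l) _.
by apply: ub_le_sup; [exact: hs.2|exists l].
Qed.

Lemma spectral_radius_le (r : R) : 0 <= r ->
  (forall l, r < rnorm l -> invertible (fun x => T x - l *: x)) ->
  spectral_radius T <= r.
Proof.
move=> r0 h; rewrite /spectral_radius; set A := [set _ | _ in _].
have [hs|/sup_out->//] := pselect (has_sup A).
apply: ge_sup; first exact: hs.1.
by move=> _ [l lT <-]; rewrite leNgt; apply/negP => /h.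
Qed.

(** The supremum bounds the spectrum only when the spectrum is known to be
    bounded, whence the disc of radius [r]. *)
Lemma invertible_beyond_spectral_radius (r : R) (l : R[i]) :
  (forall m, r < rnorm m -> invertible (fun x => T x - m *: x)) ->
  spectral_radius T < rnorm l -> invertible (fun x => T x - l *: x).
Proof.
move=> h sl; apply: contrapT => lT; move: sl; apply/negP; rewrite -leNgt.
apply: ub_le_sup; last by exists l.
by exists r => _ [m mT <-]; rewrite leNgt; apply/negP => /h.
Qed.

End SpectralRadius.

(** * The bilateral weighted shift *)

Section Shift.
Variables (R : realType) (H : completeNormedModType R[i]).
Variables (dot : {dot H for Num.conj}) (hdot : hilbert_norm dot).
Variables (e : int -> H) (he : orthonormal_basis dot e).
Variables (w : int -> R) (w_gt0 : forall n, 0 < w n).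
Variables (M : R) (wM : forall n, w n <= M).
Variables (S : {linear H -> H}) (bS : bounded_operator S).
Hypothesis S_shift : bilateral_weighted_shift e w S.
Local Notation C := (R[i])^o.
Local Notation r2 := (r2_minus w).
Local Notation r3 := (r3_plus w).
Implicit Types (x y f : H) (l : C) (k : int).

Let w0 n : 0 <= w n. Proof. exact: ltW. Qed.

Lemma coord_shift x k : dot (S x) (e (k + 1)) = (w k)%:C * dot x (e k).
Proof.
have comb (s : seq int) (c : int -> R[i]) (y := \sum_(i <- s) c i *: e i) :
    dot (S y) (e (k + 1)) = (w k)%:C * dot y (e k).
  rewrite /y linear_sum !linear_sumlz mulr_sumr; apply: eq_bigr => i _.
  rewrite linearZ/= S_shift scalerA !linearZl_LR/= !(dot_e he) (inj_eq (addIr _)).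
  by case: eqVneq => [->|_]; rewrite /GRing.scale/= ?mulr1n ?mulr1 ?mulr0// mulrC.
have [B B1 SB] := bounded_operator_ge1 bS.
apply/eqP; rewrite -subr_eq0; apply/eqP/rnorm_le0/ler_addgt0Pr => d d0.
have Bw0 : 0 < B + w k by rewrite addr_gt0// (lt_le_trans ltr01).
rewrite add0r; have [s [c]] := basis_approx he x (divr_gt0 d0 Bw0).
set y := \sum_(i <- s) _ => xy.
have -> : dot (S x) (e (k + 1)) - (w k)%:C * dot x (e k) =
    dot (S (x - y)) (e (k + 1)) - (w k)%:C * dot (x - y) (e k).
  have cy : dot (S y) (e (k + 1)) = (w k)%:C * dot y (e k) := comb s c.
  have -> : dot (S (x - y)) (e (k + 1)) = dot (S x) (e (k + 1)) - dot (S y) (e (k + 1)).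
    by rewrite linearB/= linearBl.
  have -> : dot (x - y) (e k) = dot x (e k) - dot y (e k) by rewrite linearBl.
  by rewrite cy; ring.
apply: le_trans (rnormB _ _) _; rewrite rnormM rnorm_pos//.
apply: le_trans (lerD (coord_le hdot he _ _) (ler_wpM2l (w0 k) (coord_le hdot he _ _))) _.
apply: le_trans (lerD (SB _) (lexx _)) _.
by rewrite -mulrDl mulrC -ler_pdivlMr// ltW.
Qed.

Lemma shift_injective x : S x = 0 -> x = 0.
Proof.
move=> Sx; apply: (coord_eq0 hdot he) => k.
have /eqP := coord_shift x k; rewrite Sx linear0l eq_sym mulf_eq0 => /orP[|/eqP//].
by rewrite (inj_eq (@complexI R) _ 0) gt_eqF.
Qed.

Lemma iter_shift n k : iter n S (e k) = (fwdprod w k n)%:C *: e (k + n%:Z).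
Proof.
elim: n => [|n ih]; first by rewrite fwdprod0 scale1r addr0.
rewrite iterS ih linearZ/= S_shift scalerA -rmorphM/= -fwdprodSr.
by rewrite -addrA -PoszD addn1.
Qed.

Lemma rnorm_iter_shift n k : rnorm (iter n S (e k)) = fwdprod w k n.
Proof.
by rewrite iter_shift rnormZ (rnorm_e hdot he) mulr1 rnorm_pos// ltW// fwdprod_gt0.
Qed.

(** By the Pythagorean theorem, the smallest distortion of the basis vectors is
    the smallest distortion of all vectors. *)
Lemma iter_shift_ge n (K : R) x : 0 <= K -> (forall k, K <= fwdprod w k n) ->
  K * rnorm x <= rnorm (iter n S x).
Proof.
move=> K0 hK.
have comb (s : seq int) (c : int -> R[i]) (y := \sum_(i <- s) c i *: e i) :
    K * rnorm y <= rnorm (iter n S y).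
  rewrite /y iter_linear_sum (comb_undup e s c).
  rewrite (comb_undup (fun i => iter n S (e i)) s c); pose c' i := c i *+ count_mem i s.
  have inj : injective (fun i : int => i + n%:Z) by exact: addIr.
  have -> : \sum_(i <- undup s) c' i *: iter n S (e i) =
      \sum_(j <- [seq i + n%:Z | i <- undup s])
        (c' (j - n%:Z) * (fwdprod w (j - n%:Z) n)%:C) *: e j.
    by rewrite big_map; apply: eq_bigr => i _; rewrite addrK -scalerA -iter_shift.
  rewrite -(@ler_pXn2r _ 2)// ?nnegrE ?mulr_ge0 ?rnorm_ge0// exprMn.
  rewrite !(rnorm_comb hdot he) ?map_inj_uniq ?undup_uniq// big_map mulr_sumr.
  apply: ler_sum => i _; rewrite addrK rnormM exprMn mulrC ler_wpM2l ?sqr_ge0//.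
  by rewrite rnorm_pos ?(ltW (fwdprod_gt0 _ _ _))// lerXn2r ?nnegrE// (le_trans K0 (hK i)).
have [B B1 SB] := bounded_operator_ge1 bS.
have B0 : 0 <= B by apply: le_trans B1.
apply/ler_addgt0Pr => d d0.
have Bw0 : 0 < B ^+ n + K by rewrite ltr_pwDl// exprn_gt0// (lt_le_trans ltr01).
have [s [c]] := basis_approx he x (divr_gt0 d0 Bw0).
set y := \sum_(i <- s) _ => xy.
have h1 : K * rnorm y <= rnorm (iter n S y) := comb s c.
have h2 : K * rnorm x <= K * rnorm (x - y) + K * rnorm y.
  by rewrite -mulrDr ler_wpM2l// -[in leLHS](subrK y x) rnormD.
have h3 : rnorm (iter n S y) <= B ^+ n * rnorm (x - y) + rnorm (iter n S x).
  have := iter_le n (x - y) B0 SB; rewrite iter_linearB => h.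
  have := rnorm_dist (iter n S y) (iter n S x) 0; rewrite !subr0 rnormBC.
  by move/le_trans; apply; rewrite lerD2r.
have h4 : (B ^+ n + K) * rnorm (x - y) <= d.
  by rewrite mulrC -ler_pdivlMr// ltW.
by rewrite mulrDl in h4; move: h1 h2 h3 h4 => /=; lra.
Qed.

(** The recurrence is assumed on a half-line only, because [S f - l f] will be a
    basis vector, which breaks it at one index. *)
Lemma coord_forward (f : H) (l : C) (k : int) n :
  (forall m : nat, (w (k + m%:Z))%:C * dot f (e (k + m%:Z)) = l * dot f (e (k + m%:Z + 1))) ->
  (fwdprod w k n)%:C * dot f (e k) = l ^+ n * dot f (e (k + n%:Z)).
Proof.
move=> h; elim: n => [|n ih]; first by rewrite fwdprod0 expr0 addr0 !mul1r.
rewrite fwdprodSr rmorphM/= [X in X * _]mulrC -mulrA ih mulrCA h.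
by rewrite mulrA -exprSr -addrA -PoszD addn1.
Qed.

Lemma coord_backward (f : H) (l : C) (k : int) n :
  (forall m : nat, (w (k - m.+1%:Z))%:C * dot f (e (k - m.+1%:Z)) = l * dot f (e (k - m%:Z))) ->
  (bwdprod w k n)%:C * dot f (e (k - n%:Z)) = l ^+ n * dot f (e k).
Proof.
move=> h; elim: n => [|n ih]; first by rewrite bwdprod0 expr0 subr0 !mul1r.
by rewrite bwdprodSr rmorphM/= -mulrA h mulrCA ih mulrA -exprS.
Qed.

(** All coordinates are bounded by the norm of [f], so the forward products
    cannot grow faster than the powers of [l]. *)
Lemma r3_le_of_forward (f : H) (l : C) (k : int) : l != 0 -> dot f (e k) != 0 ->
  (forall m : nat, (w (k + m%:Z))%:C * dot f (e (k + m%:Z)) = l * dot f (e (k + m%:Z + 1))) ->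
  r3 <= rnorm l.
Proof.
move=> l0 fk h; have fk0 : 0 < rnorm (dot f (e k)) by rewrite rnorm_gt0.
have f0 : 0 < rnorm f by exact: lt_le_trans fk0 (coord_le hdot he _ _).
apply: (@r3_plus_le _ _ w_gt0 _ wM k _ (rnorm f / rnorm (dot f (e k)))).
- by rewrite rnorm_gt0.
- by rewrite divr_gt0.
move=> n; rewrite mulrAC ler_pdivlMr//.
have := congr1 (@rnorm _ _) (coord_forward n h).
rewrite !rnormM rnormX rnorm_pos ?(ltW (fwdprod_gt0 _ _ _))// => ->.
by rewrite mulrC ler_wpM2r ?exprn_ge0 ?rnorm_ge0 ?coord_le.
Qed.

Lemma r2_ge_of_backward (f : H) (l : C) (k : int) : l != 0 -> dot f (e k) != 0 ->
  (forall m : nat, (w (k - m.+1%:Z))%:C * dot f (e (k - m.+1%:Z)) = l * dot f (e (k - m%:Z))) ->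
  rnorm l <= r2.
Proof.
move=> l0 fk h; have fk0 : 0 < rnorm (dot f (e k)) by rewrite rnorm_gt0.
have f0 : 0 < rnorm f by exact: lt_le_trans fk0 (coord_le hdot he _ _).
apply: (@r2_minus_ge _ _ w_gt0 _ wM k _ (rnorm f / rnorm (dot f (e k)))).
- by rewrite rnorm_gt0.
- by rewrite divr_gt0.
move=> n; rewrite mulrAC ler_pdivlMr//.
have := congr1 (@rnorm _ _) (coord_backward n h).
rewrite !rnormM rnormX rnorm_pos ?(ltW (bwdprod_gt0 _ _ _))// => <-.
by rewrite mulrC ler_wpM2r ?(ltW (bwdprod_gt0 _ _ _)) ?coord_le.
Qed.

(** The scalar [a] is 1 for the resolvent and 0 for eigenvectors. *)
Lemma resolvent_recurrence (f : H) (l a : C) (k j : int) :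
  S f - l *: f = a *: e k -> j + 1 != k ->
  (w j)%:C * dot f (e j) = l * dot f (e (j + 1)).
Proof.
move=> Sf jk; rewrite -coord_shift; apply/eqP; rewrite -subr_eq0.
rewrite -linearZl_LR -linearBl Sf linearZl_LR/= (dot_e he) [k == _]eq_sym (negbTE jk).
by rewrite mulr0.
Qed.

Lemma resolvent_at (f : H) (l a : C) (k : int) :
  S f - l *: f = a *: e (k + 1) ->
  (w k)%:C * dot f (e k) - l * dot f (e (k + 1)) = a.
Proof.
move=> Sf; rewrite -coord_shift -linearZl_LR -linearBl Sf linearZl_LR/=.
by rewrite (dot_e he) eqxx mulr1.
Qed.

Lemma resolvent_forward (f : H) (l a : C) (k : int) : l != 0 ->
  S f - l *: f = a *: e k -> dot f (e k) != 0 -> r3 <= rnorm l.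
Proof.
move=> l0 Sf fk; apply: (r3_le_of_forward l0 fk) => m.
apply: resolvent_recurrence Sf _.
by rewrite -addrA -subr_eq0 addrAC subrr add0r -PoszD addn1.
Qed.

Lemma resolvent_backward (f : H) (l a : C) (k : int) : l != 0 ->
  S f - l *: f = a *: e (k + 1) -> dot f (e k) != 0 -> rnorm l <= r2.
Proof.
move=> l0 Sf fk; apply: (r2_ge_of_backward l0 fk) => m.
have e1 : k - m.+1%:Z + 1 = k - m%:Z by rewrite -addn1 PoszD opprD addrA subrK.
rewrite -e1; apply: resolvent_recurrence Sf _; rewrite e1.
by rewrite (inj_eq (addrI k)) -subr_eq0 -opprD oppr_eq0 -PoszD addn1.
Qed.

Lemma eigenvalue_radius (x : H) (l : C) : l != 0 -> S x = l *: x -> x != 0 ->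
  r3 <= rnorm l <= r2.
Proof.
move=> l0 Sx x0.
have [k xk] : exists k, dot x (e k) != 0.
  apply: contrapT => h; move/eqP: x0; apply; apply: (coord_eq0 hdot he) => k.
  by apply: contrapT => /eqP xk; apply: h; exists k.
have eq (j : int) : S x - l *: x = (0 : C) *: e j by rewrite Sx subrr scale0r.
by rewrite (resolvent_forward l0 (eq _) xk) (resolvent_backward l0 (eq _) xk).
Qed.

Lemma coord_geom_sum u (s : H) k : geom_sum u s ->
  (forall n, dot (u n) (e k) = 0) -> dot s (e k) = 0.
Proof.
move=> [K [q [q0 q1 h]]] u0; apply: rnorm_le0; apply/ler_addgt0Pr => d d0.
have [N /(_ N (leqnn _)) /ltW hN] := geom_small K q0 q1 d0.
rewrite add0r; apply: le_trans hN; apply: le_trans (h N).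
have -> : dot s (e k) = dot (s - \sum_(n < N) u n) (e k).
  by rewrite linearBl linear_sumlz big1 ?subr0// => n _; exact: u0.
exact: coord_le.
Qed.

Lemma forward_solution (r : R) : r3 < r ->
  exists2 f, S f - r%:C *: f = e 0 & dot f (e (-1)) = 0.
Proof.
move=> r3r; have r30 := r3_plus_ge0 w_gt0 wM.
have rr : r3 < (r3 + r) / 2 < r by apply/andP; split; lra.
have [rr1 rr2] := andP rr.
have [K K0 hK] := r3_plus_lt w_gt0 wM 0 rr1.
have nr : rnorm r%:C = r by rewrite rnorm_pos// (le_trans r30) ?ltW.
have [|||s [s1 s2 _]] := @neumann_preimage _ _ S (e 0) K ((r3 + r) / 2) r%:C bS.
- by lra.
- by rewrite nr.
- by move=> n; rewrite (rnorm_iter_shift).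
exists (- r%:C^-1 *: s) => //.
rewrite linearZl_LR/= (coord_geom_sum s1) ?mulr0// => n.
rewrite (iter_shift) !linearZl_LR/= (dot_e he) add0r.
by rewrite /= !mulr0.
Qed.

(** These vectors are successive preimages of [e k], and hence the coefficients
    of the backward series. *)
Lemma backward_step k n :
  S ((bwdprod w k n.+1)^-1%:C *: e (k - n.+1%:Z)) = (bwdprod w k n)^-1%:C *: e (k - n%:Z).
Proof.
rewrite linearZ/= S_shift scalerA -rmorphM/= bwdprodSr.
rewrite (_ : k - n.+1%:Z + 1 = k - n%:Z); last first.
  by rewrite -addn1 PoszD opprD addrA subrK.
by rewrite invfM mulrC mulrCA mulfV ?mulr1// gt_eqF.
Qed.

Lemma backward_solution (r : R) : 0 < r -> r < r2 ->
  exists2 f, S f - r%:C *: f = e 0 & (w (-1))%:C * dot f (e (-1)) = 1.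
Proof.
move=> r0 rr2.
have rr : r < (r2 + r) / 2 < r2 by apply/andP; split; lra.
have [h1 h2] := andP rr; have t0 := lt_trans r0 h1.
set t := (r2 + r) / 2 in h1 h2 t0.
have [K K0 hK] := r2_minus_gt w_gt0 wM 0 t0 h2.
pose z n := (bwdprod w 0 n.+1)^-1%:C *: e (0 - n.+1%:Z).
have q0 : 0 <= t^-1 * r by rewrite mulr_ge0// ?invr_ge0 ltW.
have q1 : t^-1 * r < 1 by rewrite mulrC ltr_pdivrMr// mul1r.
have zK n : rnorm (z n) <= K / t * t^-1 ^+ n.
  rewrite rnormZ (rnorm_e hdot he) mulr1 rnorm_pos ?invr_ge0 ?(ltW (bwdprod_gt0 _ _ _))//.
  by rewrite -mulrA -exprS; exact: (bwdprod_inv_le w_gt0).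
have nr : rnorm (r%:C : C) <= r by rewrite rnorm_pos// ltW.
have ti0 : 0 <= t^-1 by rewrite invr_ge0 ltW.
have [f] := geom_sum_exists q0 q1 (fun n => power_term_le 0 n ti0 nr zK).
move=> f1 _.
have {}f1 : geom_sum (fun n => (r%:C - 0 : C) ^+ n *: z n) f.
  by apply: eq_geom_sum f1 => n; rewrite addn0 subr0.
have Sf : S f - r%:C *: f = e 0.
  apply: preimage_power_series bS _ _ f1; rewrite ?scale0r ?subr0.
    by rewrite /z backward_step bwdprod0 invr1 scale1r subr0.
  by move=> n; rewrite scale0r subr0 /z backward_step.
exists f => //.
have f0 : dot f (e 0) = 0.
  apply: coord_geom_sum f1 _ => n; rewrite !linearZl_LR/= (dot_e he).
  by rewrite sub0r oppr_eq0 /= !mulr0.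
have Sf' : S f - (r%:C : C) *: f = (1 : C) *: e (-1 + 1) by rewrite addNr scale1r.
by have := resolvent_at Sf'; rewrite addNr f0 mulr0 subr0.
Qed.

(** Approaching the common radius from below gives backward solutions, from
    above forward ones; they stay apart in the coordinate [-1], whereas the
    resolvent would be continuous there. *)
Lemma common_radius_in_spectrum : 0 < r2 -> r2 = r3 ->
  ~ invertible (fun x => S x - r2%:C *: x).
Proof.
move=> r20 r23 inv.
have [c c0 hc] := invertible_lower_bound inv.
have [_ _ /(_ (e 0))[f Sf _]] := invertible_preimage inv.
have near (d : R) (g : H) (t : R) : `|t - r2| <= d -> c * d <= 2^-1 ->
    S g - t%:C *: g = e 0 -> rnorm (g - f) <= 2 * c * rnorm f * d.
  move=> td cd Sg.
  have d0 : 0 <= d by apply: le_trans td.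
  have e1 : S (g - f) - r2%:C *: (g - f) = (t - r2)%:C *: g.
    transitivity (S g - r2%:C *: g - (S f - r2%:C *: f)).
      exact: (linearB (shift_by S r2%:C) g f).
    by rewrite Sf -Sg opprB addrC addrA subrK rmorphB scalerBl.
  have h1 : rnorm (g - f) <= c * d * rnorm g.
    have := hc (g - f); rewrite e1 rnormZ rnorm_real => /le_trans; apply.
    by rewrite -mulrA ler_pM2l// ler_wpM2r ?rnorm_ge0.
  have h2 : rnorm g <= rnorm (g - f) + rnorm f.
    by rewrite -[in leLHS](subrK f g) rnormD.
  have h3 : c * d * rnorm g <= 2^-1 * rnorm g by rewrite ler_wpM2r ?rnorm_ge0.
  have h4 : rnorm g <= 2 * rnorm f by lra.
  apply: le_trans h1 _.
  have cd0 : 0 <= c * d by rewrite mulr_ge0// ltW.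
  by have := ler_wpM2l cd0 h4; lra.
have w1 := w_gt0 (-1).
pose A := 4 * c * rnorm f * w (-1).
have A0 : 0 <= A by rewrite !mulr_ge0 ?rnorm_ge0 // ltW.
(* The first bound allows the estimate [near], the second keeps [r2 - d]
   positive, the third makes [d * A < 1]. *)
pose d := Num.min (2^-1 / c) (Num.min (r2 / 2) ((2 * (A + 1))^-1)).
have d0 : 0 < d.
  by rewrite !lt_min !divr_gt0//= invr_gt0 mulr_gt0// ltr_wpDl.
have d1 : c * d <= 2^-1 by rewrite mulrC -ler_pdivlMr// ge_min lexx.
have d2 : d <= r2 / 2 by rewrite !ge_min lexx orbT.
have d3 : d * (2 * (A + 1)) <= 1.
  have A1 : 0 < 2 * (A + 1) by rewrite mulr_gt0// ltr_wpDl.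
  by rewrite -ler_pdivlMr// mul1r !ge_min lexx !orbT.
have [|g1 Sg1 g1e] := @forward_solution (r2 + d); first by rewrite -r23 ltrDl.
have [||g2 Sg2 g2e] := @backward_solution (r2 - d); [lra|lra|].
have n1 := near d g1 _ _ d1 Sg1.
have n2 := near d g2 _ _ d1 Sg2.
have {}n1 : rnorm (g1 - f) <= 2 * c * rnorm f * d.
  by apply: n1; rewrite addrAC subrr add0r ger0_norm// ltW.
have {}n2 : rnorm (g2 - f) <= 2 * c * rnorm f * d.
  by apply: n2; rewrite addrAC subrr add0r normrN ger0_norm// ltW.
have n12 : rnorm (g2 - g1) <= 4 * c * rnorm f * d.
  by have := rnorm_dist g2 f g1; rewrite [rnorm (f - _)]rnormBC; lra.
have : (w (-1))%:C * dot (g2 - g1) (e (-1)) = 1.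
  have -> : dot (g2 - g1) (e (-1)) = dot g2 (e (-1)) - dot g1 (e (-1)).
    by rewrite linearBl.
  by rewrite g1e subr0.
move/(congr1 (@rnorm _ _)); rewrite rnormM rnorm1 rnorm_pos ?(ltW w1)// => h.
have := coord_le hdot he (g2 - g1) (-1) => h'.
have := ler_wpM2l (ltW w1) (le_trans h' n12); rewrite h.
rewrite (_ : _ * _ = d * A); last by rewrite /A; ring.
by lra.
Qed.

(** * Condition (C) *)

Let r2_ge0 : 0 <= r2 := r2_minus_ge0 w_gt0 wM.
Let r3_ge0 : 0 <= r3 := r3_plus_ge0 w_gt0 wM.

Let M_ge0 : 0 <= M.
Proof. exact: le_trans (ltW (w_gt0 0)) (wM 0). Qed.

Lemma common_bound (s : seq int) (f : int -> nat -> R) (c : int -> R) (q : R) :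
  0 <= q -> (forall i, 0 <= c i) ->
  (forall i, exists2 K, 0 < K & forall n, f i n <= K * q ^+ n) ->
  exists K, forall n, \sum_(i <- s) c i * f i n <= K * q ^+ n.
Proof.
move=> q0 c0 h; elim: s => [|i s [K hK]].
  by exists 0 => n; rewrite big_nil mul0r.
have [K' _ hK'] := h i; exists (c i * K' + K) => n.
by rewrite big_cons mulrDl lerD// -mulrA ler_wpM2l.
Qed.

Lemma local_resolvent_outer (s : seq int) (c : int -> R[i]) (l : C) :
  r3 < rnorm l -> local_resolvent_set S (\sum_(i <- s) c i *: e i) l.
Proof.
move=> r3l.
have rr : r3 < (r3 + rnorm l) / 2 < rnorm l by apply/andP; split; lra.
have [h1 h2] := andP rr; set t := (r3 + rnorm l) / 2 in h1 h2.
have t0 : 0 <= t by rewrite (le_trans r3_ge0)// ltW.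
have [K hK] := common_bound s t0 (fun i => rnorm_ge0 (c i))
  (fun i => r3_plus_lt w_gt0 wM i h1).
apply: (local_resolvent_of_growth bS t0 h2 (K := K)) => n.
apply: le_trans (hK n); rewrite iter_linear_sum.
apply: le_trans (rnorm_sum _ _ _) _; apply: ler_sum => i _.
by rewrite rnormZ (rnorm_iter_shift).
Qed.

Lemma local_resolvent_inner (s : seq int) (c : int -> R[i]) (l : C) :
  rnorm l < r2 -> local_resolvent_set S (\sum_(i <- s) c i *: e i) l.
Proof.
move=> lr2; have l0 := rnorm_ge0 l.
have rr : rnorm l < (r2 + rnorm l) / 2 < r2 by apply/andP; split; lra.
have [h1 h2] := andP rr; set t := (r2 + rnorm l) / 2 in h1 h2.
have t0 : 0 < t by exact: le_lt_trans h1.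
have ti0 : 0 <= t^-1 by rewrite invr_ge0 ltW.
have [|K hK] := @common_bound s (fun i n => (bwdprod w i n)^-1)
    (fun i => rnorm (c i)) t^-1 ti0 (fun i => rnorm_ge0 (c i)).
  move=> i; have [K K0 hK] := r2_minus_gt w_gt0 wM i t0 h2.
  by exists K => // n; exact: (bwdprod_inv_le w_gt0).
pose z n := \sum_(i <- s) c i *: ((bwdprod w i n.+1)^-1%:C *: e (i - n.+1%:Z)).
apply: (@local_resolvent_of_iterated_preimages _ _ S 0 _ z (K / t) t^-1) => //.
- by rewrite invr_gt0.
- move=> n; rewrite -mulrA -exprS; apply: le_trans (hK n.+1).
  apply: le_trans (rnorm_sum _ _ _) _; apply: ler_sum => i _.
  rewrite !rnormZ (rnorm_e hdot he) mulr1 rnorm_pos ?invr_ge0//.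
  by rewrite ltW// bwdprod_gt0.
- rewrite scale0r subr0 /z linear_sum; apply: eq_bigr => i _.
  by rewrite linearZ/= (backward_step) bwdprod0 invr1 scale1r subr0.
- move=> n; rewrite scale0r subr0 /z linear_sum; apply: eq_bigr => i _.
  by rewrite linearZ/= (backward_step).
- by rewrite subr0 invrK.
Qed.

(** Cut the negative axis into blocks of length [n]: by the action of [S ^ n] on
    one basis vector, the product of the weights of a block is at least the
    minimum modulus of [S ^ n], and the incomplete block costs a constant. *)
Lemma min_modulus_root_le_r2 n : (0 < n)%N ->
  min_modulus (iter n S) `^ n%:R^-1 <= r2.
Proof.
move=> n0; have e1 := rnorm_e hdot he.
have m0 := min_modulus_ge0 (iter n S) (e1 0).
set r := _ `^ _; have [r0|r0] := ltP 0 r; last exact: le_trans r0 r2_ge0.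
have rm : r ^+ n = min_modulus (iter n S) by exact: root_exprn.
have block k : r ^+ n <= bwdprod w k n.
  rewrite rm -[k](subrK n%:Z) -fwdprod_bwdprod.
  rewrite -(rnorm_iter_shift).
  exact: min_modulus_le.
have bwdD k a b : bwdprod w k (a + b) = bwdprod w k a * bwdprod w (k - a%:Z) b.
  elim: b => [|b ih]; first by rewrite addn0 bwdprod0 mulr1.
  rewrite addnS !bwdprodSr ih -mulrA; congr (_ * (_ * w _)).
  by rewrite -addrA -opprD -PoszD addnS.
pose K := 1 + \sum_(i < n) r ^+ i / bwdprod w 0 i.
have K1 : 1 <= K.
  by rewrite lerDl sumr_ge0// => i _; rewrite divr_ge0 ?exprn_ge0 ?ltW// bwdprod_gt0.
have K0 : 0 < K by exact: lt_le_trans K1.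
apply: (r2_minus_ge w_gt0 wM (k := 0) r0 K0) => N.
elim/ltn_ind: N => N ih; have [nN|Nn] := leqP n N.
  rewrite -(subnK nN) bwdD exprD mulrA.
  apply: ler_pM; rewrite ?exprn_ge0 ?(ltW r0)//.
  by apply: ih; rewrite ltn_subrL n0 (leq_trans n0).
rewrite -ler_pdivrMr ?bwdprod_gt0// /K (bigD1 (Ordinal Nn))//= addrCA lerDl.
by rewrite addr_ge0// sumr_ge0// => i _; rewrite divr_ge0 ?exprn_ge0 ?ltW// bwdprod_gt0.
Qed.

Lemma r1_le_r2 : r1 S <= r2.
Proof.
apply: ge_sup; first by exists (min_modulus (iter 1 S) `^ 1%:R^-1), 1%N.
by move=> _ [n /= n0 <-]; exact: min_modulus_root_le_r2.
Qed.

Lemma min_modulus_root_le_r1 n : (0 < n)%N ->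
  min_modulus (iter n S) `^ n%:R^-1 <= r1 S.
Proof.
move=> n0; apply: ub_le_sup; last by exists n.
by exists r2 => _ [m /= m0 <-]; exact: min_modulus_root_le_r2.
Qed.

Lemma r1_ge0 : 0 <= r1 S.
Proof. exact: le_trans (powR_ge0 _ _) (min_modulus_root_le_r1 (ltn0Sn 0)). Qed.

(** Below [r3] the resolvent at a positive number can only be the backward one;
    its norm bounds all the quotients of weights uniformly, hence the minimum
    modulus of the powers from below. *)
Lemma r1_ge (r : R) : 0 < r -> r < r3 ->
  invertible (fun x => S x - r%:C *: x) -> r <= r1 S.
Proof.
move=> r0 rr3 /invertible_preimage[c c0 hc].
have nr : rnorm (r%:C : C) = r by rewrite rnorm_pos// ltW.
have rC : (r%:C : C) != 0 by rewrite -rnorm_gt0 nr.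
have bwd k n : r ^+ n / c <= bwdprod w (k + 1) n.+1.
  have [f Sf fc] := hc (e (k + 1)); rewrite (rnorm_e hdot he) mulr1 in fc.
  have Sf' : S f - (r%:C : C) *: f = (1 : C) *: e (k + 1) by rewrite scale1r.
  have fk1 : dot f (e (k + 1)) = 0.
    apply/eqP/negPn/negP => h.
    have := resolvent_forward rC Sf' h.
    by rewrite nr leNgt rr3.
  have := resolvent_at Sf'.
  rewrite fk1 mulr0 subr0 => fk.
  have rel (m : nat) : (w (k - m.+1%:Z))%:C * dot f (e (k - m.+1%:Z)) =
      (r%:C : C) * dot f (e (k - m%:Z)).
    have e1 : k - m.+1%:Z + 1 = k - m%:Z by rewrite -addn1 PoszD opprD addrA subrK.
    rewrite -e1; apply: (resolvent_recurrence Sf').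
    by rewrite e1 (inj_eq (addrI k)) -subr_eq0 -opprD oppr_eq0 -PoszD addn1.
  have := congr1 (@rnorm _ _) (coord_backward n rel).
  have := congr1 (@rnorm _ _) fk.
  rewrite !rnormM rnormX nr rnorm1 !rnorm_pos ?(ltW (bwdprod_gt0 _ _ _)) ?(ltW (w_gt0 _))//.
  move=> fk' fn; rewrite bwdprodS ler_pdivrMr// -mulrA.
  have -> : r ^+ n = w k * (bwdprod w k n * rnorm (dot f (e (k - n%:Z)))).
    by rewrite fn mulrCA fk' mulr1.
  rewrite ler_pM2l// ler_pM2l ?bwdprod_gt0//.
  exact: le_trans (coord_le hdot he _ _) fc.
have mod n : r ^+ n / c <= min_modulus (iter n.+1 S).
  have rc0 : 0 <= r ^+ n / c by rewrite divr_ge0 ?exprn_ge0 ?ltW.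
  apply: (min_modulus_ge (rnorm_e hdot he 0)) => y.
  apply: (iter_shift_ge) => // k.
  by rewrite fwdprod_bwdprod -[_ + _](subrK 1).
rewrite leNgt; apply/negP => r1r.
have q0 : 0 <= r1 S / r by rewrite divr_ge0 ?r1_ge0 ?ltW.
have q1 : r1 S / r < 1 by rewrite ltr_pdivrMr// mul1r.
have [N /(_ N.+1 (leqnSn N))] := geom_small (r * c) q0 q1 ltr01.
apply/negP; rewrite -leNgt expr_div_n.
have h : r ^+ N / c <= r1 S ^+ N.+1.
  apply: le_trans (mod N) _.
  by rewrite -root_le ?r1_ge0 ?min_modulus_root_le_r1 ?(min_modulus_ge0 _ (rnorm_e hdot he 0)).
rewrite ler_pdivrMr// in h.
rewrite mulrA ler_pdivlMr ?exprn_gt0// mul1r exprS -mulrA ler_pM2l// mulrC.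
exact: h.
Qed.

Section ConditionC.
Hypothesis S_C : dunford_condition_C S.

(** Basis vectors lie in the local spectral subspace of [F], so condition (C)
    puts the whole space there. *)
Lemma condition_C_surjective (F : set C) (l : C) : closed F ->
  (forall s c m, ~ F m -> local_resolvent_set S (\sum_(i <- s) c i *: e i) m) ->
  ~ F l -> forall y, exists x, S x - l *: x = y.
Proof.
move=> cF comb Fl y.
have SF : local_spectral_subspace S F y.
  apply: (closed_rnorm (S_C cF)) => d d0.
  have [s [c yd]] := basis_approx he y d0.
  exists (\sum_(i <- s) c i *: e i) => // m mS.
  by apply: contrapT => /comb - /(_ s c).
apply: local_resolvent_preimage.
by apply: contrapT => lS; apply: Fl; exact: SF.
Qed.

Lemma surjective_outer (l : C) : r3 < rnorm l ->
  forall y, exists x, S x - l *: x = y.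
Proof.
move=> r3l; apply: (condition_C_surjective (closed_rnorm_le (r := r3))) => [s c m|].
  by move=> /negP; rewrite -ltNge; exact: local_resolvent_outer.
by apply/negP; rewrite -ltNge.
Qed.

Lemma surjective_inner (l : C) : rnorm l < r2 ->
  forall y, exists x, S x - l *: x = y.
Proof.
move=> lr2; apply: (condition_C_surjective (closed_rnorm_ge (r := r2))) => [s c m|].
  by move=> /negP; rewrite -ltNge; exact: local_resolvent_inner.
by apply/negP; rewrite -ltNge.
Qed.

(** Were [r3 < r2], every [S - l] would be onto. Just above [r2] it would also be
    one-to-one, with a lower bound that does not degenerate at [r2]; but just
    below [r2] the forward and backward solutions differ by an eigenvector. *)
Lemma r2_le_r3 : r2 <= r3.
Proof.
rewrite leNgt; apply/negP => r32.
have surj (l : C) : forall y, exists x, S x - l *: x = y.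
  have [h|h] := ltP (rnorm l) r2; first exact: surjective_inner.
  by apply: surjective_outer; exact: lt_le_trans h.
have r20 : 0 < r2 by exact: le_lt_trans r32.
have [c c0 hc] := open_mapping (shift_by_bounded r2%:C bS) (surj r2%:C).
(* The first bound allows [uniform_lower_bound], the second keeps [r2 - d] above
   [r3], the third makes the lower bound at [m] exceed the distance [2 * d] from
   [m] to the eigenvalue [t]. *)
pose d := Num.min (2^-1 / c) (Num.min ((r2 - r3) / 2) (4 * (2 * c + 1))^-1).
have c1 : 0 < 2 * c + 1 by rewrite addr_gt0// mulr_gt0.
have d0 : 0 < d.
  by rewrite !lt_min !divr_gt0//= ?subr_gt0// invr_gt0 mulr_gt0.
have d1 : c * d <= 2^-1 by rewrite mulrC -ler_pdivlMr// ge_min lexx.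
have d2 : d <= (r2 - r3) / 2 by rewrite !ge_min lexx orbT.
have d3 : d * (4 * (2 * c + 1)) <= 1.
  by rewrite -ler_pdivlMr ?mulr_gt0// mul1r !ge_min lexx !orbT.
pose m := r2 + d; pose t := r2 - d.
have m0 : 0 <= m by rewrite addr_ge0// ltW.
have inv : invertible (fun x => S x - m%:C *: x).
  apply: (bijective_resolvent bS (surj m%:C)) => x Sx; apply: contrapT => /eqP x0.
  have mC : (m%:C : C) != 0 by rewrite -rnorm_gt0 rnorm_pos// /m addr_gt0.
  have := eigenvalue_radius mC Sx x0.
  rewrite rnorm_pos// => /andP[_]; rewrite /m; lra.
have low := @uniform_lower_bound _ _ S r2%:C m%:C c c0 hc inv.
have {low} low x : rnorm x <= (2 * c + 1) * rnorm (S x - m%:C *: x).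
  by apply: low; rewrite -rmorphB rnorm_real /m addrAC subrr add0r ger0_norm// ltW.
have [|f Sf fe] := forward_solution (r := t).
  by rewrite /t; lra.
have [||g Sg ge] := backward_solution (r := t).
- by move: r3_ge0; rewrite /t; lra.
- by rewrite /t; lra.
have Sx : S (g - f) - m%:C *: (g - f) = (t - m)%:C *: (g - f).
  have e1 : S (g - f) - t%:C *: (g - f) = 0.
    transitivity (S g - t%:C *: g - (S f - t%:C *: f)).
      exact: (linearB (shift_by S t%:C) g f).
    by rewrite Sf Sg subrr.
  by move/eqP: e1; rewrite subr_eq0 => /eqP ->; rewrite -scalerBl -rmorphB.
have x0 : g - f != 0.
  apply/eqP => /subr0_eq gf; move: ge; rewrite gf fe mulr0 => /eqP.
  by rewrite eq_sym oner_eq0.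
have := low (g - f); rewrite Sx rnormZ rnorm_real.
have -> : `|t - m| = 2 * d.
  by rewrite /t /m opprD addrACA subrr add0r -opprD normrN ger0_norm ?addr_ge0 ?ltW//; lra.
have nx : 0 < rnorm (g - f) by rewrite rnorm_gt0.
rewrite mulrA -[leLHS]mul1r ler_pM2r//; lra.
Qed.

Lemma invertible_outer (l : C) : r3 < rnorm l -> invertible (fun x => S x - l *: x).
Proof.
move=> r3l; apply: bijective_resolvent => // [|x Sx]; first exact: surjective_outer.
apply: contrapT => /eqP x0.
have l0 : l != 0 by rewrite -rnorm_gt0 (le_lt_trans r3_ge0).
have /andP[_ h] := eigenvalue_radius l0 Sx x0.
by have := r2_le_r3; lra.
Qed.

Lemma invertible_inner (l : C) : rnorm l < r2 -> invertible (fun x => S x - l *: x).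
Proof.
move=> lr2; apply: bijective_resolvent => // [|x Sx]; first exact: surjective_inner.
have [l0|l0] := eqVneq l 0.
  by apply: (shift_injective); rewrite Sx l0 scale0r.
apply: contrapT => /eqP x0.
have /andP[h _] := eigenvalue_radius l0 Sx x0.
by have := r2_le_r3; lra.
Qed.

Lemma r3_eq_spectral_radius : r3 = spectral_radius S.
Proof.
apply/eqP; rewrite eq_le; apply/andP; split; last first.
  by apply: spectral_radius_le => // l; exact: invertible_outer.
rewrite leNgt; apply/negP => sr3.
have s0 := spectral_radius_ge0 S.
have inv (r : R) : spectral_radius S < r -> invertible (fun x => S x - r%:C *: x).
  move=> sr; apply: (@invertible_beyond_spectral_radius _ _ S r3).
    exact: invertible_outer.
  by rewrite rnorm_pos// (le_trans s0)// ltW.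
have [r23|r23] := ltP r2 r3; last first.
  have e23 : r2 = r3 by apply/eqP; rewrite eq_le r2_le_r3.
  have r20 : 0 < r2 by rewrite e23 (le_lt_trans s0).
  apply: (common_radius_in_spectrum r20 e23).
  by apply: inv; rewrite e23.
pose r := (Num.max r2 (spectral_radius S) + r3) / 2.
have mr3 : Num.max r2 (spectral_radius S) < r3 by rewrite gt_max r23.
have r2m : r2 <= Num.max r2 (spectral_radius S) by rewrite le_max lexx.
have sm : spectral_radius S <= Num.max r2 (spectral_radius S).
  by rewrite le_max lexx orbT.
have rr3 : r < r3 by rewrite /r; lra.
have r2r : r2 < r by rewrite /r; lra.
have sr : spectral_radius S < r by rewrite /r; lra.
have r0 : 0 < r by exact: le_lt_trans r2r.
have nr : rnorm (r%:C : C) = r by rewrite rnorm_pos// ltW.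
have rC : (r%:C : C) != 0 by rewrite -rnorm_gt0 nr.
have [c _ /(_ (e (-1 + 1)))[f Sf _]] := invertible_preimage (inv _ sr).
have Sf' : S f - (r%:C : C) *: f = (1 : C) *: e (-1 + 1) by rewrite scale1r.
have f0 : dot f (e (-1 + 1)) = 0.
  apply/eqP/negPn/negP => h.
  have := resolvent_forward rC Sf' h.
  by rewrite nr leNgt rr3.
have f1 : dot f (e (-1)) = 0.
  apply/eqP/negPn/negP => h.
  have := resolvent_backward rC Sf' h.
  by rewrite nr leNgt r2r.
have := resolvent_at Sf'.
by rewrite f0 f1 !mulr0 subr0 => /eqP; rewrite eq_sym oner_eq0.
Qed.

Lemma noninvertible_case : ~ invertible S -> r1 S = r2 /\ r2 = 0.
Proof.
move=> Sn; have r20 : r2 = 0.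
  apply/eqP; rewrite eq_le r2_ge0 andbT leNgt; apply/negP => r2p; apply: Sn.
  apply: bijective_invertible => // [y|]; last first.
    exact: (shift_injective).
  have [|x Sx] := @surjective_inner 0 _ y; first by rewrite rnorm0.
  by exists x; rewrite -Sx scale0r subr0.
split => //; apply/eqP; rewrite eq_le r1_le_r2/=.
by rewrite r20; exact: r1_ge0.
Qed.

Section Invertible.
Variable Sinv : {linear H -> H}.
Hypothesis S_inv : inverse_operator S Sinv.
Local Notation s := (spectral_radius Sinv).

Let s_ge0 : 0 <= s := spectral_radius_ge0 Sinv.

Lemma r2_gt0 : 0 < r2.
Proof.
have [bG SK _] := S_inv; have [B B1 GB] := bounded_operator_ge1 bG.
have B0 : 0 < B by exact: lt_le_trans B1.
have wB k : B^-1 <= w k.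
  rewrite -div1r ler_pdivrMr// mulrC.
  have := GB (S (e k)); rewrite SK (rnorm_e hdot he).
  by rewrite S_shift rnormZ (rnorm_e hdot he) mulr1 rnorm_pos// ltW.
apply: (@lt_le_trans _ _ B^-1); first by rewrite invr_gt0.
apply: (r2_minus_ge w_gt0 wM (k := 0) _ ltr01) => [|n]; first by rewrite invr_gt0.
rewrite mul1r -[X in _ ^+ X](card_ord n) -prodr_const; apply: ler_prod => i _.
by rewrite invr_ge0 (ltW B0) wB.
Qed.

Lemma inverse_outer (l : C) : r2^-1 < rnorm l ->
  invertible (fun x => Sinv x - l *: x).
Proof.
move=> rl; have [bG SK GK] := S_inv; have r20 := r2_gt0.
have l0 : 0 < rnorm l by apply: le_lt_trans rl; rewrite invr_ge0.
apply: (invertible_inverse_shift bG GK SK); first by rewrite -rnorm_gt0.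
apply: invertible_inner.
by rewrite rnormV -[r2]invrK ltf_pV2 ?posrE ?invr_gt0.
Qed.

(** Inversion exchanges the complement of a disc for [S^-1] and a punctured disc
    for [S]; the product form of the hypothesis includes [s = 0]. *)
Lemma invertible_below (r : R) : 0 < r -> r * s < 1 ->
  invertible (fun x => S x - r%:C *: x).
Proof.
move=> r0 rs; have [bG SK GK] := S_inv.
have nr : rnorm (r%:C : C) = r by rewrite rnorm_pos// ltW.
have rC : (r%:C : C) != 0 by rewrite -rnorm_gt0 nr.
apply: (invertible_inverse_shift bS SK GK rC).
apply: (invertible_beyond_spectral_radius inverse_outer).
by rewrite rnormV nr -div1r ltr_pdivlMr// mulrC.
Qed.

(** If [r3 * s < 1], the inequality [r1_ge] would apply up to [r3], and the
    radii [r2] and [r3] would coincide at a point outside the spectrum. *)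
Lemma invertible_case : r1 S = s^-1 /\ s^-1 = r2.
Proof.
have r20 := r2_gt0; have r23 := r2_le_r3; have r12 := r1_le_r2.
have below (r : R) : 0 < r -> r < r3 -> r * s < 1 -> r <= r1 S.
  by move=> r0 rr3 rs; apply: r1_ge => //; exact: invertible_below.
have {}below (r : R) : r <= r3 -> (forall t, t < r -> t * s < 1) -> r <= r1 S.
  move=> rr3 rs; rewrite leNgt; apply/negP => h.
  pose t := (r1 S + r) / 2.
  have tr : t < r by rewrite /t; lra.
  have r1t : r1 S < t by rewrite /t; lra.
  have := below t (le_lt_trans r1_ge0 r1t) (lt_le_trans tr rr3) (rs _ tr).
  by rewrite leNgt r1t.
have r3s : 1 <= r3 * s.
  rewrite leNgt; apply/negP => r3s.
  have r31 : r3 <= r1 S.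
    apply: below => // t tr; apply: le_lt_trans r3s.
    by rewrite ler_wpM2r// ltW.
  have e23 : r2 = r3.
    by apply/eqP; rewrite eq_le r23 (le_trans r31).
  apply: (common_radius_in_spectrum r20 e23).
  by apply: invertible_below => //; rewrite e23.
have s0 : 0 < s.
  by rewrite lt_def s_ge0 andbT; apply: contraTN r3s => /eqP ->; rewrite mulr0 ler10.
have h1 : s^-1 <= r1 S.
  apply: below => [|t ts]; first by rewrite -div1r ler_pdivrMr.
  by rewrite -ltr_pdivlMr// div1r.
have h2 : r2 <= s^-1.
  rewrite -[r2]invrK lef_pV2 ?posrE ?invr_gt0//.
  apply: spectral_radius_le; first by rewrite invr_ge0.
  exact: inverse_outer.
split; apply/eqP; rewrite eq_le.
  by rewrite h1 (le_trans r12).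
by rewrite h2 (le_trans h1).
Qed.

End Invertible.
End ConditionC.
End Shift.

Theorem theorem4p9 (R : realType) (H : completeNormedModType R[i])
    (dot : {dot H for Num.conj}) (hdot : hilbert_norm dot)
    (e : int -> H) (he : orthonormal_basis dot e)
    (w : int -> R) (w_gt0 : forall n : int, 0 < w n)
    (w_bounded : exists M : R, forall n : int, w n <= M)
    (S : {linear H -> H}) (S_bounded : bounded_operator S)
    (S_shift : bilateral_weighted_shift e w S)
    (S_C : dunford_condition_C S) :
  (~ invertible S ->
     [/\ r1 S = r2_minus w, r2_minus w = 0, 0 <= r3_plus w
       & r3_plus w = spectral_radius S]) /\
  (forall Sinv : {linear H -> H}, inverse_operator S Sinv ->
     [/\ r1 S = (spectral_radius Sinv)^-1,
         (spectral_radius Sinv)^-1 = r2_minus w,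
         r2_minus w <= r3_plus w
       & r3_plus w = spectral_radius S]).
Proof.
have [M wM] := w_bounded; split => [Sn|Sinv S_inv].
  have [r12 r20] := noninvertible_case hdot he w_gt0 wM S_bounded S_shift S_C Sn.
  split=> //; first exact: (r3_plus_ge0 w_gt0 wM).
  exact: (r3_eq_spectral_radius hdot he w_gt0 wM S_bounded S_shift S_C).
have [r1s sr2] := invertible_case hdot he w_gt0 wM S_bounded S_shift S_C S_inv.
split=> //; first exact: (r2_le_r3 hdot he w_gt0 wM S_bounded S_shift S_C).
exact: (r3_eq_spectral_radius hdot he w_gt0 wM S_bounded S_shift S_C).
Qed.
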